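(* Let $\varepsilon=(\varepsilon_j)_{j\in\Gamma}$ be a summable family with $\varepsilon_j>0$ for all $j\in\Gamma$. Define a symmetric, positive definite, trace class operator $A$ on $H^2$ by $$\forall X\in H^2,\quad AX=\sum_{j\in\Gamma}\varepsilon_j\langle X,u_j\rangle u_j+\varepsilon_j\langle X,v_j\rangle v_j .$$ Set $\|X\|_A=\langle AX,X\rangle^{1/2}$. Then $\|\cdot\|_A$ is a measurable norm on $H^2$. Denote by $B_A$ the completion of $H^2$ for this norm. If $F\in S_m(\mathcal B,\varepsilon)$ with $m\ge2$, then $F$ is uniformly continuous on $H^2$ with respect to the norm $\|\cdot\|_A$. The function $F$ admits a uniformly continuous extension $F_A$ on $B_A$, and, for every $h>0$ and $p\in[1,+\infty[$, the stochastic extension $\tilde F$ of $F$ in $L^p(B_A,\mu_{B_A,h})$ is equal to $F_A$ $\mu_{B_A,h}$-almost everywhere.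
   Context: $H$ is a real, separable, infinite dimensional Hilbert space and $H^2$ has the product Hilbert structure, with scalar product $\langle\cdot,\cdot\rangle$ and norm $|\cdot|$. A norm $\|\cdot\|$ on a separable Hilbert space $\mathcal K$ is measurable (Gross) if for every $\eta>0$ there is a finite rank orthogonal projection $P_0$ such that for every finite rank orthogonal projection $P$ with $P\perp P_0$, the standard Gaussian measure of $\{x\in P(\mathcal K):\|x\|>\eta\}$ on $P(\mathcal K)$ is less than $\eta$. If $W$ is the completion of $\mathcal K$ for a measurable norm, $\mathcal K$ is identified with its dual so that $W'\subset\mathcal K\subset W$; for $h>0$, $\mu_{W,h}$ is the Gaussian probability measure of variance $h$ on the Borel $\sigma$-algebra of $W$: for $y_1,\dots,y_n\in W'$ orthonormal in $\mathcal K$, the image of $\mu_{W,h}$ under $x\mapsto(y_1(x),\dots,y_n(x))$ is $(2\pi h)^{-n/2}e^{-|v|^2/(2h)}dv$ on $\mathbb R^n$. For $a\in\mathcal K$, $\ell_a\in L^2(W,\mu_{W,h})$ is the image of $a$ under the continuous extension to $\mathcal K$ of the map $W'\ni y\mapsto y(\cdot)$. For a finite dimensional subspace $E\subset\mathcal K$ with orthonormal basis $(w_1,\dots,w_n)$, $\tilde\pi_E(x)=\sum_j\ell_{w_j}(x)w_j$ for $x\in W$. A Borel function $f$ on $\mathcal K$ admits $\tilde f$ as a stochastic extension in $L^p(W,\mu_{W,h})$ if, for every increasing sequence $(E_n)$ of finite dimensional subspaces of $\mathcal K$ with dense union, $f\circ\tilde\pi_{E_n}\in L^p(W,\mu_{W,h})$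 and $f\circ\tilde\pi_{E_n}\to\tilde f$ in $L^p(W,\mu_{W,h})$. It is known that functions in $S_m(\mathcal B,\varepsilon)$, $m\ge1$, $\varepsilon$ summable, admit stochastic extensions in every such $L^p$, $p\in[1,\infty[$. Let $B$ be a Banach space completing $H$ for a measurable norm. $\mathcal B=(e_j)_{j\in\Gamma}$ is a Hilbert basis of $H$ ($\Gamma$ countable) with all $e_j\in B'$; $u_j=(e_j,0)$, $v_j=(0,e_j)$. For $m\in\mathbb N$, $M\ge0$, $S_m(\mathcal B,M,\varepsilon)$ is the set of bounded continuous $F:H^2\to\mathbb C$ such that for every pair of finitely supported multi-indices $(\alpha,\beta)$ with $0\le\alpha_j,\beta_j\le m$ for all $j$, the derivative $\prod_{j}\partial_{u_j}^{\alpha_j}\partial_{v_j}^{\beta_j}F$ exists, is continuous on $H^2$ and is bounded in modulus by $M\prod_j\varepsilon_j^{\alpha_j+\beta_j}$; $S_m(\mathcal B,\varepsilon)=\bigcup_{M\ge0}S_m(\mathcal B,M,\varepsilon)$. *)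

(* Defs.v *)
From HB Require Import structures.
From mathcomp Require Import all_boot all_order all_algebra finmap complex ring lra.
From mathcomp Require Import all_classical all_reals all_analysis.
From mathcomp Require summability.

Set Implicit Arguments.
Unset Strict Implicit.
Unset Printing Implicit Defensive.

Import Order.TTheory GRing.Theory Num.Theory.
Import numFieldNormedType.Exports.

Local Open Scope classical_set_scope.
Local Open Scope ring_scope.

HB.mixin Record isHilbert (R : realType) H & CompleteNormedModule R H := {
  dotp : H -> H -> R;
  dotpC : forall x y, dotp x y = dotp y x;
  dotpDl : forall x y z, dotp (x + y) z = dotp x z + dotp y z;
  dotpZl : forall a x y, dotp (a *: x) y = a * dotp x y;
  dotpxx : forall x, dotp x x = `|x| ^+ 2
}.

#[short(type="hilbertType")]
HB.structure Definition Hilbert (R : realType) :=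
  {H of CompleteNormedModule R H & isHilbert R H}.

(* The product Hilbert space; an alias is needed because the library equips
   [H1 * H2] with the max norm. *)
Definition hprod (H1 H2 : Type) : Type := (H1 * H2)%type.

Section hprod.
Context (R : realType) (H1 H2 : hilbertType R).
Implicit Types x y z : hprod H1 H2.

HB.instance Definition _ :=
  GRing.Lmodule.copy (hprod H1 H2) (H1 * H2)%type.

Definition hprod_norm x : R := Num.sqrt (`|x.1| ^+ 2 + `|x.2| ^+ 2).

Let sqrt_sqrD (a b c d : R) :
  Num.sqrt ((a + b) ^+ 2 + (c + d) ^+ 2) <=
  Num.sqrt (a ^+ 2 + c ^+ 2) + Num.sqrt (b ^+ 2 + d ^+ 2).
Proof.
have P (u v : R) : 0 <= u ^+ 2 + v ^+ 2 by rewrite addr_ge0 ?sqr_ge0.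
set s := Num.sqrt (a ^+ 2 + _); set t := Num.sqrt (b ^+ 2 + _).
have s0 : 0 <= s := sqrtr_ge0 _; have t0 : 0 <= t := sqrtr_ge0 _.
have s2 : s ^+ 2 = a ^+ 2 + c ^+ 2 by rewrite sqr_sqrtr.
have t2 : t ^+ 2 = b ^+ 2 + d ^+ 2 by rewrite sqr_sqrtr.
rewrite -(@ler_pXn2r _ 2)// ?nnegrE ?addr_ge0 ?sqrtr_ge0// sqr_sqrtr//.
suff : a * b + c * d <= s * t by nra.
apply: le_trans (ler_norm _) _.
rewrite -(@ler_pXn2r _ 2)// ?nnegrE ?mulr_ge0//.
rewrite real_normK ?num_real// exprMn s2 t2.
have := sqr_ge0 (a * d - b * c); nra.
Qed.

Let normD x y : hprod_norm (x + y) <= hprod_norm x + hprod_norm y.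
Proof.
apply: le_trans (sqrt_sqrD _ _ _ _); rewrite ler_wsqrtr// lerD//.
  by rewrite ler_pXn2r ?nnegrE ?addr_ge0// ler_normD.
by rewrite ler_pXn2r ?nnegrE ?addr_ge0// ler_normD.
Qed.

Let normZ (a : R) x : hprod_norm (a *: x) = `|a| * hprod_norm x.
Proof.
rewrite /hprod_norm !normrZ !exprMn -mulrDr sqrtrM ?sqr_ge0//.
by rewrite sqrtr_sqr normr_id.
Qed.

Let norm_eq0 x : hprod_norm x = 0 -> x = 0.
Proof.
move=> /eqP; rewrite sqrtr_eq0 => x0.
have {}x0 : `|x.1| ^+ 2 + `|x.2| ^+ 2 == 0 :> R.
  by rewrite eq_le x0 addr_ge0 ?sqr_ge0.
move: x0; rewrite paddr_eq0 ?sqr_ge0// !sqrf_eq0 !normr_eq0.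
by case: x => a b /= /andP[/eqP-> /eqP->].
Qed.

HB.instance Definition _ :=
  @Lmodule_isNormed.Build R (hprod H1 H2) hprod_norm normD normZ norm_eq0.

Lemma hprod_normE x : `|x| = Num.sqrt (`|x.1| ^+ 2 + `|x.2| ^+ 2).
Proof. by []. Qed.

Let norm_fst x : `|x.1| <= `|x|.
Proof.
by rewrite hprod_normE -[leLHS]normr_id -sqrtr_sqr ler_wsqrtr// lerDl sqr_ge0.
Qed.

Let norm_snd x : `|x.2| <= `|x|.
Proof.
by rewrite hprod_normE -[leLHS]normr_id -sqrtr_sqr ler_wsqrtr// lerDr sqr_ge0.
Qed.

Let norm_le x : `|x| <= `|x.1| + `|x.2|.
Proof.
have := sqrt_sqrD `|x.1| 0 0 `|x.2|.
by rewrite !addr0 !add0r expr0n/= addr0 add0r !sqrtr_sqr !normr_id hprod_normE.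
Qed.

Let hprod_complete (F : set_system (hprod H1 H2)) :
  ProperFilter F -> cauchy F -> cvg F.
Proof.
move=> FF /cauchyP Fc.
have c1 : cauchy (fst @ F).
  apply/cauchyP => _ /posnumP[e].
  have [x Fx] := Fc e%:num (gt0 e); exists x.1.
  suff : F [set y | ball x.1 e%:num y.1] by [].
  apply: filterS Fx => y xy; rewrite /= -ball_normE /ball_/=.
  by apply: le_lt_trans (norm_fst (x - y)) _; move: xy; rewrite -ball_normE.
have c2 : cauchy (snd @ F).
  apply/cauchyP => _ /posnumP[e].
  have [x Fx] := Fc e%:num (gt0 e); exists x.2.
  suff : F [set y | ball x.2 e%:num y.2] by [].
  apply: filterS Fx => y xy; rewrite /= -ball_normE /ball_/=.
  by apply: le_lt_trans (norm_snd (x - y)) _; move: xy; rewrite -ball_normE.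
have /cvg_ex[/= a Fa] : cvg (fst @ F) by exact: cauchy_cvg.
have /cvg_ex[/= b Fb] : cvg (snd @ F) by exact: cauchy_cvg.
apply/cvg_ex; exists ((a, b) : hprod H1 H2); apply/cvgrPdist_lt => _ /posnumP[e].
move/cvgrPdist_lt : Fa => /(_ (e%:num / 2) ltac:(by [])) Fa.
move/cvgrPdist_lt : Fb => /(_ (e%:num / 2) ltac:(by [])) Fb.
near=> x; apply: le_lt_trans (norm_le _) _; rewrite [ltRHS]splitr ltrD//=.
  by near: x.
by near: x.
Unshelve. all: by end_near. Qed.

HB.instance Definition _ :=
  Uniform_isComplete.Build (hprod H1 H2) hprod_complete.

Definition hprod_dotp x y : R := dotp x.1 y.1 + dotp x.2 y.2.

Let hprod_dotpC x y : hprod_dotp x y = hprod_dotp y x.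
Proof. by congr +%R; exact: dotpC. Qed.

Let hprod_dotpDl x y z :
  hprod_dotp (x + y) z = hprod_dotp x z + hprod_dotp y z.
Proof. by rewrite /hprod_dotp !dotpDl addrACA. Qed.

Let hprod_dotpZl a x y : hprod_dotp (a *: x) y = a * hprod_dotp x y.
Proof. by rewrite /hprod_dotp !dotpZl mulrDr. Qed.

Let hprod_dotpxx x : hprod_dotp x x = `|x| ^+ 2.
Proof.
by rewrite hprod_normE sqr_sqrtr ?addr_ge0 ?sqr_ge0// /hprod_dotp !dotpxx.
Qed.

HB.instance Definition _ := @isHilbert.Build R (hprod H1 H2)
  hprod_dotp hprod_dotpC hprod_dotpDl hprod_dotpZl hprod_dotpxx.

End hprod.

Definition separable_space (T : topologicalType) :=
  exists2 D : set T, countable D & dense D.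

Section hilbert_notions.
Context (R : realType) (K : hilbertType R).

Definition linspan (n : nat) (w : 'I_n -> K) : set K :=
  [set x | exists c : 'I_n -> R, x = \sum_i c i *: w i].

Definition infinite_dimensional :=
  forall (n : nat) (w : 'I_n -> K), linspan w <> setT.

Definition orthonormal_family (I : eqType) (w : I -> K) :=
  forall i j, dotp (w i) (w j) = (i == j)%:R.

Definition hilbert_basis (I : choiceType) (e : I -> K) :=
  orthonormal_family e /\
  dense [set x | exists (J : {fset I}) (c : I -> R),
                   x = \sum_(j <- J) c j *: e j].

(* For orthonormal families [w], these are all the finite rank orthogonal projections. *)
Definition orthoproj (n : nat) (w : 'I_n -> K) (x : K) : K :=
  \sum_i dotp x (w i) *: w i.

Definition symmetric_op (T : K -> K) :=
  forall x y, dotp (T x) y = dotp x (T y).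

(* [S] is |T|, the nonnegative square root of the adjoint of T times T. *)
Definition is_abs_op (T S : K -> K) :=
  [/\ linear S, continuous S, symmetric_op S, forall x, 0 <= dotp (S x) x
    & forall x y, dotp (S (S x)) y = dotp (T x) (T y)].

Definition trace_class (T : K -> K) :=
  [/\ linear T, continuous T
    & exists2 S, is_abs_op T S &
      forall (I : countType) (f : I -> K), hilbert_basis f ->
        (\esum_(i in setT) (dotp (S (f i)) (f i))%:E < +oo)%E].

Definition is_norm (N : K -> R) :=
  [/\ forall x y, N (x + y) <= N x + N y,
      forall a x, N (a *: x) = `|a| * N x
    & forall x, N x = 0 -> x = 0].

End hilbert_notions.

Section lebesgue_tuple.
Context (R : realType).
Local Notation T := (measurableTypeR R).

Let tcons n (x : T * n.-tuple T) : n.+1.-tuple T := [tuple of x.1 :: x.2].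

Let measurable_tcons n : measurable_fun setT (@tcons n).
Proof. exact: measurable_cons. Qed.

Section step.
Context (n : nat) (mu : {sigma_finite_measure set (n.-tuple T) -> \bar R}).

Let nu : set (n.+1.-tuple T) -> \bar R :=
  pushforward (@lebesgue_measure R \x mu)%E (@tcons n).

Let measurable_preimage A : measurable A -> measurable (@tcons n @^-1` A).
Proof.
by move=> mA; rewrite -[X in measurable X]setTI; exact: measurable_tcons.
Qed.

Let nu0 : nu set0 = 0%E.
Proof. by rewrite /nu/pushforward preimage_set0 measure0. Qed.

Let nu_ge0 A : (0 <= nu A)%E.
Proof. by rewrite /nu/pushforward measure_ge0. Qed.

Let nu_sigma_additive : semi_sigma_additive nu.
Proof.
move=> F mF tF mUF; rewrite /nu/pushforward preimage_bigcup.
apply: measure_semi_sigma_additive.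
- by move=> k; exact: measurable_preimage.
- apply/trivIsetP => /= i j _ _ ij; rewrite -preimage_setI.
  by move/trivIsetP : tF => /(_ _ _ _ _ ij) ->//; rewrite preimage_set0.
- by rewrite -preimage_bigcup; exact: measurable_preimage.
Qed.

HB.instance Definition _ := isMeasure.Build _ _ _ nu
  nu0 nu_ge0 nu_sigma_additive.

Let nu_sigma_finite : sigma_finite setT nu.
Proof.
have /sigma_finiteP[F [TF ndF Foo]] := sigma_finiteT (@lebesgue_measure R).
have /sigma_finiteP[G [TG ndG Goo]] := sigma_finiteT mu.
pose g (v : n.+1.-tuple T) : T * n.-tuple T := (thead v, [tuple of behead v]).
have gK : cancel g (@tcons n) by move=> v; apply/val_inj; case: v => -[].
have tK : cancel (@tcons n) g.
  by case=> a v; congr pair; apply/val_inj.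
have mg : measurable_fun setT g.
  apply/measurable_fun_pairP; split.
    exact: measurable_tnth.
  exact: measurable_behead.
exists (fun k => g @^-1` (F k `*` G k)).
  rewrite -preimage_bigcup predeqE => v; split=> // _.
  have [i _ Fi] : (\bigcup_i F i) (g v).1 by rewrite -TF.
  have [j _ Gj] : (\bigcup_i G i) (g v).2 by rewrite -TG.
  exists (maxn i j) => //; split.
  - by move: Fi; apply/subsetPset/ndF/leq_maxl.
  - by move: Gj; apply/subsetPset/ndG/leq_maxr.
move=> k; have [mF Fk] := Foo k; have [mG Gk] := Goo k.
split.
  by rewrite -[X in measurable X]setTI; apply: mg => //; exact: measurableX.
rewrite /nu/pushforward -comp_preimage (_ : g \o _ = idfun).
  by rewrite preimage_id product_measure1E// lte_mul_pinfty// ge0_fin_numE.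
exact/funext.
Qed.

HB.instance Definition _ :=
  Measure_isSigmaFinite.Build _ _ _ nu nu_sigma_finite.

Definition lebesgue_tuple_step :
  {sigma_finite_measure set (n.+1.-tuple T) -> \bar R} := nu.

End step.

Fixpoint lebesgue_tuple (n : nat) :
    {sigma_finite_measure set (n.-tuple T) -> \bar R} :=
  match n with
  | 0 => dirac [tuple]
  | n'.+1 => lebesgue_tuple_step (lebesgue_tuple n')
  end.

End lebesgue_tuple.

Definition gauss_pdf (R : realType) (n : nat) (h : R)
    (v : n.-tuple (measurableTypeR R)) : R :=
  (2 * pi * h) `^ (- (n%:R / 2)) *
  expR (- (\sum_(i < n) tnth v i ^+ 2) / (2 * h)).

Definition gauss (R : realType) (n : nat) (h : R)
    (A : set (n.-tuple (measurableTypeR R))) : \bar R :=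
  (\int[lebesgue_tuple R n]_(v in A) (gauss_pdf h v)%:E)%E.

Section wiener.
Context (R : realType) (K : hilbertType R).

(* The standard Gaussian measure of the range of [orthoproj w] (for an
   orthonormal [w]), read in the coordinates given by [w]. *)
Definition std_gauss_range (n : nat) (w : 'I_n -> K) (A : set K) : \bar R :=
  gauss 1 [set v : n.-tuple (measurableTypeR R) |
            A (\sum_(i < n) (tnth v i : R) *: w i)].

Definition measurable_norm (N : K -> R) :=
  is_norm N /\
  forall eta : R, 0 < eta ->
  exists (n0 : nat) (w0 : 'I_n0 -> K), orthonormal_family w0 /\
  forall (n : nat) (w : 'I_n -> K), orthonormal_family w ->
    (forall x y, dotp (orthoproj w x) (orthoproj w0 y) = 0) ->
    (std_gauss_range w [set x | (eta < N x)%R] < eta%:E)%E.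

Definition is_completion (N : K -> R) (W : completeNormedModType R)
    (iota : K -> W) :=
  [/\ linear iota, forall x, `|iota x| = N x & dense (range iota)].

Definition borel (W : completeNormedModType R) : Type :=
  g_sigma_algebraType (@open W).

HB.instance Definition _ W := Measurable.on (borel W).

Context (W : completeNormedModType R) (iota : K -> W).

(* [y : K] belongs to W' (viewed in K), and [y'] is the corresponding
   continuous linear form on W. *)
Definition dual_repr (y' : W -> R) (y : K) :=
  [/\ scalar y', continuous y' & forall x, y' (iota x) = dotp y x].

Definition in_dual (y : K) := exists y', dual_repr y' y.

Definition gaussian_measure (h : R) (mu : probability (borel W) R) :=
  forall (n : nat) (y : 'I_n -> K) (y' : 'I_n -> W -> R),
    orthonormal_family y -> (forall i, dual_repr (y' i) (y i)) ->
    forall A : set (n.-tuple (measurableTypeR R)), measurable A ->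
      mu [set x : borel W | A [tuple (y' i x : R) | i < n]] = gauss h A.

Section stochastic_extension.
Context (mu : probability (borel W) R).

(* [f] is (a representative of) \ell_a, the value at [a] of the continuous
   extension to K of the map W' -> L^2(W, mu). *)
Definition is_ell (a : K) (f : borel W -> R) :=
  [/\ measurable_fun setT f, ('N[mu]_2%:E[EFin \o f] < +oo)%E
    & forall eps : R, 0 < eps -> exists2 delta : R, 0 < delta &
        forall y y', dual_repr y' y -> `|y - a| < delta ->
          ('N[mu]_2%:E[(fun x => (y' x - f x)%:E)] < eps%:E)%E].

Definition cLnorm (p : R) (f : borel W -> R[i]) : \bar R :=
  'N[mu]_(p%:E)[(fun x => (Normc.normc (f x))%:E)].

Definition in_Lp (p : R) (f : borel W -> R[i]) :=
  [/\ measurable_fun setT (fun x => complex.Re (f x)),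
      measurable_fun setT (fun x => complex.Im (f x))
    & (cLnorm p f < +oo)%E].

(* With [w] an orthonormal basis of E and [l i] representing \ell_(w i), this
   is (a representative of) \tilde\pi_E. *)
Definition tpi (n : nat) (w : 'I_n -> K) (l : 'I_n -> borel W -> R)
  (x : borel W) : K := \sum_i l i x *: w i.

(* The finite dimensional subspaces E_n are given by orthonormal bases [w n];
   the condition is required for all choices of the bases and of the
   representatives of the \ell's. *)
Definition stochastic_extension (p : R) (f : K -> R[i])
    (ft : borel W -> R[i]) :=
  in_Lp p ft /\
  forall (d : nat -> nat) (w : forall n, 'I_(d n) -> K)
    (l : forall n, 'I_(d n) -> borel W -> R),
    (forall n, orthonormal_family (w n)) ->
    (forall n, linspan (w n) `<=` linspan (w n.+1)) ->
    dense (\bigcup_n linspan (w n)) ->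
    (forall n i, is_ell (w n i) (l n i)) ->
    (forall n, in_Lp p (f \o tpi (w n) (l n))) /\
    cLnorm p (fun x => f (tpi (w n) (l n) x) - ft x) @[n --> \oo] --> 0%E.

End stochastic_extension.
End wiener.

Section symbols.
Context (R : realType) (H : hilbertType R) (Gamma : countType) (e : Gamma -> H).
Implicit Types F G : hprod H H -> R[i]^o.

Definition basis_u (j : Gamma) : hprod H H := (e j, 0).
Definition basis_v (j : Gamma) : hprod H H := (0, e j).

Definition direction (d : Gamma + Gamma) : hprod H H :=
  match d with inl j => basis_u j | inr j => basis_v j end.

Definition is_dderiv F (a : hprod H H) G :=
  forall X, (t^-1)%:C%C * (F (X + t *: a) - F X) @[t --> (0 : R)^'] --> G X.

(* [G] is the iterated derivative of [F] along the directions listed in [s]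
   (the last one is applied first). *)
Fixpoint is_iter_dderiv (s : seq (Gamma + Gamma)) F G : Prop :=
  match s with
  | [::] => G = F
  | d :: s' => exists2 G', is_iter_dderiv s' F G' & is_dderiv G' (direction d) G
  end.

Definition lists_multiindex (alpha beta : Gamma -> nat)
    (s : seq (Gamma + Gamma)) :=
  forall j, count_mem (inl j) s = alpha j /\ count_mem (inr j) s = beta j.

(* No order of differentiation is privileged: all orders are allowed. *)
Definition symbol_class_bound (m : nat) (M : R) (eps : Gamma -> R) F :=
  [/\ exists C : R, forall X, Normc.normc (F X) <= C,
      continuous F
    & forall alpha beta : Gamma -> nat,
        finite_set [set j | alpha j != 0%N] ->
        finite_set [set j | beta j != 0%N] ->
        (forall j, (alpha j <= m)%N /\ (beta j <= m)%N) ->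
        forall s, lists_multiindex alpha beta s ->
        exists G, [/\ is_iter_dderiv s F G, continuous G
          & forall X, Normc.normc (G X) <=
              M * \big[*%R/1]_(j \in [set: Gamma]) (eps j ^+ (alpha j + beta j))]].

Definition symbol_class (m : nat) (eps : Gamma -> R) F :=
  exists2 M : R, 0 <= M & symbol_class_bound m M eps F.

Definition opA_term (eps : Gamma -> R) (X : hprod H H) (j : Gamma) :
    hprod H H :=
  (eps j * dotp X (basis_u j)) *: basis_u j +
  (eps j * dotp X (basis_v j)) *: basis_v j.

Definition opA (eps : Gamma -> R) (X : hprod H H) : hprod H H :=
  summability.sum (opA_term eps X).

Definition normA (eps : Gamma -> R) (X : hprod H H) : R :=
  Num.sqrt (dotp (opA eps X) X).

End symbols.

(* Main.v *)
(** The function [F] is Lipschitz for the norm defined by [A]: moving along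
    [u_j] or [v_j] changes [F] by at most [M * eps j] per unit of length, and
    the Cauchy-Schwarz inequality with weights [eps j] turns the sum of these
    variations into a multiple of the norm. The inf-convolution formula of
    McShane, applied to the real and the imaginary part, then extends [F] to a
    Lipschitz function on the completion.

    Everything else is a computation in mean square. A centred Gaussian
    variable of covariance [h] satisfies [E q(x) = h * trace q] for a positive
    form [q] (only [E q(x) = c * trace q] for some finite [c] is used), so that
    Chebyshev's inequality gives the measurability of the norm; and the squared
    norm of [x - tpi_E x] has expectation at most a constant times
    [sum_d eps d * |d - P_E d|^2], [d] ranging over the basis of [H^2], which
    tends to 0 as [E] grows. As [F] is bounded and Lipschitz, [F o tpi_E]
    therefore converges in every L^p to the extension, and limits in L^p are
    unique. *)

Require Import Defs.
From HB Require Import structures.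
From mathcomp Require Import all_boot all_order all_algebra finmap complex.
From mathcomp Require Import all_classical all_reals all_analysis.
From mathcomp Require summability.
From mathcomp Require Import measurable_realfun ring lra.

Set Implicit Arguments.
Unset Strict Implicit.
Unset Printing Implicit Defensive.

Import Order.TTheory GRing.Theory Num.Theory.
Import numFieldNormedType.Exports.

Local Open Scope classical_set_scope.
Local Open Scope ring_scope.

(** * Hilbert spaces *)

(** Two obstacles shape the estimates. The hypothesis on [mu] describes only the laws of continuous
    forms on the completion, whereas the [l i] in [tpi] are arbitrary representatives attached to
    vectors that need not lie in W'. Each is replaced, up to a small mean-square error, by the form
    of a finite combination of basis vectors; this is possible because every basis vector does lie
    in W' for the norm defined by [A]. Next, the norm of the completion has no explicit formula: up
    to a constant, its square is the supremum of finite weighted sums of squares of the coordinate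
    forms, so its mean is estimated by monotone convergence. The measurability of the norm and the
    convergence of the projections have one source, the smallness of the weights outside a finite
    set [s0]. Orthogonality to the [g d] with [d] in [s0] removes their weights from the trace; for
    large E, these finitely many [g d] are nearly in E and the remaining terms weigh little. Both
    arguments use only finite sums over an orthonormal family, which is what [diagonal_form]
    isolates from H^2. *)

Section hilbert_basics.
Context (R : realType) (K : hilbertType R).
Implicit Types x y z : K.

Lemma dotpDr x y z : dotp x (y + z) = dotp x y + dotp x z.
Proof. by rewrite dotpC dotpDl !(dotpC x). Qed.

Lemma dotpZr a x y : dotp x (a *: y) = a * dotp x y.
Proof. by rewrite dotpC dotpZl dotpC. Qed.

Lemma dotp0l x : dotp 0 x = 0.
Proof. by rewrite -(scale0r x) dotpZl mul0r. Qed.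

Lemma dotp0r x : dotp x 0 = 0.
Proof. by rewrite dotpC dotp0l. Qed.

Lemma dotpNl x y : dotp (- x) y = - dotp x y.
Proof. by rewrite -scaleN1r dotpZl mulN1r. Qed.

Lemma dotpNr x y : dotp x (- y) = - dotp x y.
Proof. by rewrite dotpC dotpNl dotpC. Qed.

Lemma dotpBl x y z : dotp (x - y) z = dotp x z - dotp y z.
Proof. by rewrite dotpDl dotpNl. Qed.

Lemma dotpBr x y z : dotp x (y - z) = dotp x y - dotp x z.
Proof. by rewrite dotpDr dotpNr. Qed.

Lemma dotp_suml (I : Type) (s : seq I) (f : I -> K) y :
  dotp (\sum_(i <- s) f i) y = \sum_(i <- s) dotp (f i) y.
Proof. exact: (big_morph (dotp^~ y) (fun a b => dotpDl a b y) (dotp0l y)). Qed.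

Lemma dotp_sumr (I : Type) (s : seq I) (f : I -> K) y :
  dotp y (\sum_(i <- s) f i) = \sum_(i <- s) dotp y (f i).
Proof. exact: (big_morph (dotp y) (dotpDr y) (dotp0r y)). Qed.

Lemma dotp_ge0 x : 0 <= dotp x x.
Proof. by rewrite dotpxx sqr_ge0. Qed.

Lemma normD_sqr x y :
  `|x + y| ^+ 2 = `|x| ^+ 2 + 2 * dotp x y + `|y| ^+ 2.
Proof. by rewrite -!dotpxx dotpDl !dotpDr (dotpC y x); ring. Qed.

Section positive_operator.
Context (T : K -> K).
Hypotheses (T_lin : linear T) (T_sym : symmetric_op T).
Hypothesis T_ge0 : forall x, 0 <= dotp (T x) x.

Lemma linearopD x y : T (x + y) = T x + T y.
Proof. by have := T_lin 1 x y; rewrite !scale1r. Qed.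

Lemma linearop0 : T 0 = 0.
Proof. by apply: (addrI (T 0)); rewrite -linearopD !addr0. Qed.

Lemma linearopZ a x : T (a *: x) = a *: T x.
Proof. by have := T_lin a x 0; rewrite linearop0 !addr0. Qed.

Lemma formD x y :
  dotp (T (x + y)) (x + y) =
  dotp (T x) x + 2 * dotp (T x) y + dotp (T y) y.
Proof.
by rewrite linearopD dotpDl !dotpDr (dotpC (T y) x) -T_sym; ring.
Qed.

Lemma formZ a x : dotp (T (a *: x)) (a *: x) = a ^+ 2 * dotp (T x) x.
Proof. by rewrite linearopZ dotpZl dotpZr; ring. Qed.

(** The polynomial with value [dotp (T (x + t *: y)) (x + t *: y)] at [t] is nonnegative. The form
    may be degenerate, hence the separate case [c = 0]. The identity gives the usual inequality; the
    operator itself serves in [diag_op_bound]. *)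
Lemma form_CauchySchwarz x y :
  dotp (T x) y ^+ 2 <= dotp (T x) x * dotp (T y) y.
Proof.
set a := dotp (T x) x; set b := dotp (T x) y; set c := dotp (T y) y.
have a0 : 0 <= a := T_ge0 x.
have c0 : 0 <= c := T_ge0 y.
have P t : 0 <= a + 2 * t * b + t ^+ 2 * c.
  have := T_ge0 (x + t *: y).
  by rewrite formD formZ dotpZr -/a -/b -/c mulrA.
have [c_eq0|cN0] := eqVneq c 0.
  have [->|b0] := eqVneq b 0; first by rewrite expr0n mulr_ge0.
  (* For [c = 0] the polynomial is affine and would take the value [-1] at this point. *)
  have := P (- (a + 1) / (2 * b)).
  rewrite c_eq0 mulr0 addr0 (_ : 2 * _ * b = - (a + 1)); last by field.
  by lra.
have := P (- b / c); rewrite -(ler_pM2r (x := c)) ?lt_neqAle 1?eq_sym ?cN0//.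
have -> : (a + 2 * (- b / c) * b + (- b / c) ^+ 2 * c) * c = a * c - b ^+ 2.
  by field.
by rewrite mul0r subr_ge0.
Qed.

Lemma sqrt_formD x y :
  Num.sqrt (dotp (T (x + y)) (x + y)) <=
  Num.sqrt (dotp (T x) x) + Num.sqrt (dotp (T y) y).
Proof.
rewrite -(@ler_pXn2r _ 2)// ?nnegrE ?addr_ge0 ?sqrtr_ge0//.
rewrite sqr_sqrtr// sqrrD !sqr_sqrtr// formD -addrA [leRHS]addrAC addrA.
rewrite -[leRHS]addrA [X in _ <= _ + X]addrC addrA lerD2r lerD2l.
rewrite -[leRHS]mulr_natl ler_wpM2l//.
rewrite (le_trans (ler_norm _))// -sqrtrM//.
by rewrite -sqrtr_sqr ler_wsqrtr// form_CauchySchwarz.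
Qed.

Lemma sqrt_formZ a x :
  Num.sqrt (dotp (T (a *: x)) (a *: x)) = `|a| * Num.sqrt (dotp (T x) x).
Proof. by rewrite formZ sqrtrM ?sqr_ge0// sqrtr_sqr. Qed.

End positive_operator.

Lemma CauchySchwarz x y : `|dotp x y| <= `|x| * `|y|.
Proof.
rewrite -(@ler_pXn2r _ 2)// ?nnegrE ?mulr_ge0// real_normK ?num_real//.
rewrite exprMn -!dotpxx.
by apply: (@form_CauchySchwarz id) => //; exact: dotp_ge0.
Qed.

Section orthonormal.
Context (I : eqType) (w : I -> K).
Hypothesis ow : orthonormal_family w.

Definition proj_seq (s : seq I) x := \sum_(i <- s) dotp x (w i) *: w i.

Lemma dotp_comb (s : seq I) (c : I -> R) j : uniq s ->
  dotp (\sum_(i <- s) c i *: w i) (w j) = if j \in s then c j else 0.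
Proof.
move=> us; rewrite dotp_suml; under eq_bigr do rewrite dotpZl ow.
case: ifPn => js.
  rewrite (bigD1_seq j)//= eqxx mulr1 big1 ?addr0// => i /negPf ->.
  by rewrite mulr0.
rewrite big_seq big1// => i si; case: eqVneq => [ij|]; last by rewrite mulr0.
by move: js; rewrite -ij si.
Qed.

(** Pythagoras: [x - proj_seq s x] is orthogonal to the [w i] with [i] in [s]. The case [c = 0]
    gives Bessel's inequality; dropping the last sum gives the best approximation. *)
Lemma proj_seqB x s (c : I -> R) : uniq s ->
  `|x - \sum_(i <- s) c i *: w i| ^+ 2 =
  `|x - proj_seq s x| ^+ 2 + \sum_(i <- s) (dotp x (w i) - c i) ^+ 2.
Proof.
move=> us; pose z := \sum_(i <- s) (dotp x (w i) - c i) *: w i.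
have -> : x - \sum_(i <- s) c i *: w i = (x - proj_seq s x) + z.
  have -> : z = proj_seq s x - \sum_(i <- s) c i *: w i.
    by rewrite -sumrB; apply: eq_bigr => i _; rewrite scalerBl.
  by rewrite addrA subrK.
rewrite normD_sqr.
have -> : dotp (x - proj_seq s x) z = 0.
  rewrite dotp_sumr big_seq big1// => i si.
  by rewrite dotpZr dotpBl dotp_comb// si subrr mulr0.
rewrite mulr0 addr0; congr +%R; rewrite -dotpxx {2}/z dotp_sumr.
rewrite big_seq [RHS]big_seq; apply: eq_bigr => i si.
by rewrite dotpZr dotp_comb// si.
Qed.

Lemma proj_seq_norm x s : uniq s ->
  `|x| ^+ 2 = `|x - proj_seq s x| ^+ 2 + \sum_(i <- s) dotp x (w i) ^+ 2.
Proof.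
move=> us; have := proj_seqB x (fun=> 0) us.
rewrite big1 => [|i _]; last by rewrite scale0r.
by rewrite subr0 => ->; under eq_bigr do rewrite subr0.
Qed.

Lemma Bessel x s : uniq s -> \sum_(i <- s) dotp x (w i) ^+ 2 <= `|x| ^+ 2.
Proof. by move=> us; rewrite (proj_seq_norm x us) lerDr sqr_ge0. Qed.

Lemma proj_seq_best x s (c : I -> R) : uniq s ->
  `|x - proj_seq s x| <= `|x - \sum_(i <- s) c i *: w i|.
Proof.
move=> us; rewrite -(@ler_pXn2r _ 2)// ?nnegrE// (proj_seqB x c us) lerDl.
by rewrite sumr_ge0// => i _; exact: sqr_ge0.
Qed.

Lemma proj_seq_le x s : uniq s -> `|x - proj_seq s x| <= `|x|.
Proof.
move=> us; have := proj_seq_best x (fun=> 0) us.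
by rewrite big1 => [|i _]; rewrite ?scale0r// subr0.
Qed.

(** Density of the span, stated through projections: in [diag_lipschitz] the coefficients of the
    approximant must be the inner products that the form weighs. *)
Definition total_family := forall x (delta : R), 0 < delta ->
  exists2 s, uniq s & `|x - proj_seq s x| < delta.

End orthonormal.

Lemma hilbert_basis_total (I : choiceType) (w : I -> K) :
  hilbert_basis w -> total_family w.
Proof.
move=> [ow dw] x delta d0.
have [||y [xy [J [c yE]]]] := dw (ball x delta).
- by exists x; exact: ballxx.
- exact: ball_open.
exists J; first exact: fset_uniq.
apply: le_lt_trans (proj_seq_best ow x c (fset_uniq J)) _.
by move: xy; rewrite -ball_normE /= yE.
Qed.

Lemma total_family_eq0 (I : eqType) (w : I -> K) x : total_family w ->
  (forall i, dotp x (w i) = 0) -> x = 0.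
Proof.
move=> tw x0; apply/eqP; rewrite -normr_le0; apply/ler_addgt0Pr => e e0.
have [s us] := tw x e e0.
rewrite /proj_seq big1 ?subr0 ?add0r; first exact: ltW.
by move=> i _; rewrite x0 scale0r.
Qed.

Lemma orthonormal_norm (I : eqType) (w : I -> K) i :
  orthonormal_family w -> `|w i| = 1.
Proof.
move=> ow; have := ow i i; rewrite dotpxx eqxx => /eqP.
rewrite sqrf_eq1 => /orP[/eqP//|/eqP h].
by have := normr_ge0 (w i); rewrite h lerNr oppr0 ler10.
Qed.

End hilbert_basics.

(** * Diagonal operators *)

Section bounded_sums.
Context (R : realType) (I : eqType) (a : I -> R).

Definition bounded_sums := exists C, forall s, uniq s -> \sum_(i <- s) a i <= C.

Hypothesis a0 : forall i, 0 <= a i.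

(** A list whose sum comes within [delta] of the supremum leaves less than [delta] to any list
    disjoint from it. This replaces the remainder of a series, with no enumeration of [I]. *)
Lemma bounded_sums_tail (delta : R) : bounded_sums -> 0 < delta ->
  exists2 s0, uniq s0 & forall s, uniq s -> (forall i, i \in s -> i \notin s0) ->
    \sum_(i <- s) a i < delta.
Proof.
move=> [C aC] d0.
pose E := [set \sum_(i <- s) a i | s in [set s | uniq s]].
have hE : has_sup E.
  split; first by exists 0, [::] => //; rewrite big_nil.
  by exists C => _ [s us <-]; exact: aC.
have [_ [s0 us0 <-] h] := sup_adherent d0 hE.
exists s0 => // s us ss0.
have : \sum_(i <- s0 ++ s) a i <= sup E.
  apply: ub_le_sup; first by case: hE.
  exists (s0 ++ s) => //=; rewrite cat_uniq us0 us andbT /=.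
  by apply/hasPn => i /ss0.
by rewrite big_cat/=; lra.
Qed.

Lemma ler_sum_subset (b : I -> R) s s' : (forall i, 0 <= b i) ->
  uniq s -> uniq s' -> {subset s <= s'} ->
  \sum_(i <- s) b i <= \sum_(i <- s') b i.
Proof.
move=> b0 us us' ss'; rewrite [leRHS](bigID (mem s))/= -[leLHS]addr0 lerD//.
  rewrite -[leRHS]big_filter le_eqVlt; apply/orP; left; apply/eqP/perm_big.
  apply: uniq_perm => //; first exact: filter_uniq.
  move=> i; rewrite mem_filter; case: (boolP (i \in s)) => //= is_.
  by rewrite ss'.
by rewrite sumr_ge0.
Qed.

Lemma sum_CauchySchwarz (c : I -> R) s :
  (\sum_(i <- s) a i * `|c i|) ^+ 2 <=
  (\sum_(i <- s) a i) * \sum_(i <- s) a i * c i ^+ 2.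
Proof.
elim: s => [|i s IH]; first by rewrite !big_nil expr0n mul0r.
rewrite !big_cons -(real_normK (num_real (c i))).
have S0 : 0 <= \sum_(i <- s) a i by rewrite sumr_ge0.
have Q0 : 0 <= \sum_(i <- s) a i * c i ^+ 2.
  by rewrite sumr_ge0// => j _; rewrite mulr_ge0 ?sqr_ge0.
have A0 : 0 <= \sum_(i <- s) a i * `|c i|.
  by rewrite sumr_ge0// => j _; rewrite mulr_ge0.
move: IH S0 Q0 A0 (a0 i) (normr_ge0 (c i)).
set S := \sum_(i <- s) a i; set Q := \sum_(i <- s) a i * c i ^+ 2.
set A := \sum_(i <- s) _; set x := `|c i|; set e := a i => IH S0 Q0 A0 e0 x0.
(* Only the cross term is left. Since [A ^+ 2 <= S * Q] by induction, it is handled by the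
   arithmetic-geometric inequality for [S * x ^+ 2] and [Q], proved by squaring. *)
suff : 2 * (A * x) <= S * x ^+ 2 + Q.
  move=> h; have := ler_wpM2l e0 h; nra.
rewrite -(@ler_pXn2r _ 2)// ?nnegrE ?addr_ge0 ?mulr_ge0 ?sqr_ge0//.
have := ler_wpM2r (sqr_ge0 x) IH; have := sqr_ge0 (S * x ^+ 2 - Q); nra.
Qed.

End bounded_sums.

Lemma summable_bounded_sums (R : realType) (I : countType) (a : I -> R) :
  (forall i, 0 <= a i) -> esum.summable [set: I] (fun i => (a i)%:E) ->
  bounded_sums a.
Proof.
move=> a0; rewrite summableE; under eq_esum do rewrite gee0_abs ?lee_fin//.
move=> fin; exists (fine (\esum_(i in [set: I]) (a i)%:E)) => s us.
rewrite -lee_fin fineK// -sumEFin; apply: esum_ge.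
exists [set` s]; first by split => //; exact: finite_seq.
by rewrite -fsbig_seq.
Qed.

Section diagonal_form_def.
Context (R : realType) (K : hilbertType R) (D : eqType).
Context (g : D -> K) (ep : D -> R).

Definition qsum (s : seq D) (X : K) : R :=
  \sum_(d <- s) ep d * dotp X (g d) ^+ 2.

(* The form of [T] is the sum of [ep d * dotp X (g d) ^+ 2] over all [d]; only
   its description as a supremum of finite sums is used. *)
Record diagonal_form (T : K -> K) : Prop := DiagonalForm {
  diag_orthonormal : orthonormal_family g;
  diag_total : total_family g;
  diag_gt0 : forall d, 0 < ep d;
  diag_bounded : bounded_sums ep;
  diag_linear : linear T;
  diag_sym : symmetric_op T;
  diag_le : forall s X, uniq s -> qsum s X <= dotp (T X) X;
  diag_ub : forall X c, (forall s, uniq s -> qsum s X <= c) ->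
    dotp (T X) X <= c }.

End diagonal_form_def.

Section diagonal_operator.
Context (R : realType) (H : hilbertType R) (Gamma : countType).
Context (e : Gamma -> H) (eps : Gamma -> R).
Hypotheses (e_basis : hilbert_basis e) (eps_gt0 : forall j, 0 < eps j).
Hypothesis eps_sum : bounded_sums eps.

Local Notation K := (hprod H H).
Local Notation g := (direction e).
Local Notation A := (opA e eps).

Definition weight (d : Gamma + Gamma) : R :=
  match d with inl j | inr j => eps j end.

Lemma weight_gt0 d : 0 < weight d. Proof. by case: d => j /=. Qed.

Lemma dotp_hprod (x y : K) : dotp x y = dotp x.1 y.1 + dotp x.2 y.2.
Proof. by []. Qed.

Lemma direction_orthonormal : orthonormal_family g.
Proof.
have [oe _] := e_basis.
by move=> [i|i] [j|j]; rewrite dotp_hprod /= ?oe ?dotp0l ?dotp0r ?addr0 ?add0r.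
Qed.

Definition both (s : seq Gamma) : seq (Gamma + Gamma) :=
  map inl s ++ map inr s.

Lemma both_uniq s s' : uniq s -> uniq s' ->
  uniq (map inl s ++ map inr s' : seq (Gamma + Gamma)).
Proof.
move=> us us'; rewrite cat_uniq !map_inj_uniq ?us ?us'//; last 2 first.
- by move=> ? ? [].
- by move=> ? ? [].
by rewrite andbT; apply/hasPn => _ /mapP[j _ ->]; apply/mapP => -[].
Qed.

Lemma direction_total : total_family g.
Proof.
have [oe _] := e_basis => -[x1 x2] delta d0.
have d20 : 0 < delta / 2 by rewrite divr_gt0.
have [s1 us1 h1] := hilbert_basis_total e_basis x1 d20.
have [s2 us2 h2] := hilbert_basis_total e_basis x2 d20.
exists (map inl s1 ++ map inr s2); first exact: both_uniq.
have -> : (x1, x2) - proj_seq g (map inl s1 ++ map inr s2) (x1, x2) =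
    (x1 - proj_seq e s1 x1, x2 - proj_seq e s2 x2) :> K.
  rewrite /proj_seq big_cat !big_map/=.
  have fstD (a b : K) : (a + b).1 = a.1 + b.1 by [].
  have sndD (a b : K) : (a + b).2 = a.2 + b.2 by [].
  have fst_sum (I : Type) (s : seq I) (f : I -> K) :
      (\sum_(i <- s) f i).1 = \sum_(i <- s) (f i).1.
    exact: (big_morph (fun x : K => x.1) fstD).
  have snd_sum (I : Type) (s : seq I) (f : I -> K) :
      (\sum_(i <- s) f i).2 = \sum_(i <- s) (f i).2.
    exact: (big_morph (fun x : K => x.2) sndD).
  have pairE (a b : H * H) : a.1 = b.1 -> a.2 = b.2 -> a = b.
    by case: a b => [? ?] [? ?] /= -> ->.
  have fstN (a : K) : (- a).1 = - a.1 by [].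
  have sndN (a : K) : (- a).2 = - a.2 by [].
  apply: pairE; rewrite ?fstD ?sndD ?fstN ?sndN ?fstD ?sndD ?fst_sum ?snd_sum/=;
    congr (_ - _).
    rewrite [X in _ + X]big1 ?addr0 => [|i _]; last exact: scaler0.
    apply: eq_bigr => i _; congr (_ *: _).
    by rewrite dotp_hprod/= dotp0r addr0.
  rewrite [X in X + _]big1 ?add0r => [|i _]; last exact: scaler0.
  apply: eq_bigr => i _; congr (_ *: _).
  by rewrite dotp_hprod/= dotp0r add0r.
rewrite hprod_normE/= (@le_lt_trans _ _ (Num.sqrt
  ((`|x1 - proj_seq e s1 x1| + `|x2 - proj_seq e s2 x2|) ^+ 2)))//.
  rewrite ler_wsqrtr// sqrrD -addrA lerD2l lerDr mulrn_wge0// mulr_ge0//.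
by rewrite sqrtr_sqr ger0_norm ?addr_ge0//; lra.
Qed.

Lemma weight_bounded : bounded_sums weight.
Proof.
have [C hC] := eps_sum; exists (C + C) => s us.
have := @both_uniq (pmap (fun d => if d is inl j then Some j else None) s)
                   (pmap (fun d => if d is inr j then Some j else None) s).
set s1 := pmap _ s; set s2 := pmap _ s => h.
have u1 : uniq s1.
  by apply: (pmap_uniq (g := inl)) us; case.
have u2 : uniq s2.
  by apply: (pmap_uniq (g := inr)) us; case.
apply: le_trans (lerD (hC _ u1) (hC _ u2)).
rewrite -(big_map inl predT weight) -(big_map inr predT weight) -big_cat/=.
apply: ler_sum_subset => //; first by move=> d; exact/ltW/weight_gt0.
  exact: h.
move=> [j|j] js; rewrite mem_cat map_f ?orbT//.
  by rewrite mem_pmap; apply/mapP; exists (inl j).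
by rewrite mem_pmap; apply/mapP; exists (inr j).
Qed.

Lemma partial_sumE (V : zmodType) (f : Gamma -> V) (J : {fset Gamma}) :
  summability.partial_sum f J = \sum_(j <- J) f j.
Proof. by rewrite /summability.partial_sum big_seq_fsetE. Qed.

Lemma opA_term_both (X Y : K) (s : seq Gamma) :
  dotp (\sum_(j <- s) opA_term e eps X j) Y =
  \sum_(d <- both s) weight d * (dotp X (g d) * dotp Y (g d)).
Proof.
rewrite big_cat !big_map/= -big_split dotp_suml/=; apply: eq_bigr => j _.
by rewrite dotpDl !dotpZl !(dotpC Y) !mulrA.
Qed.

Lemma opA_term_le (X : K) j : `|opA_term e eps X j| <= 2 * `|X| * eps j.
Proof.
have h d : `|(eps j * dotp X (g d)) *: g d| <= `|X| * eps j.
  rewrite normrZ (orthonormal_norm _ direction_orthonormal) mulr1.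
  rewrite normrM (gtr0_norm (eps_gt0 j)) mulrC ler_wpM2r ?(ltW (eps_gt0 j))//.
  apply: le_trans (CauchySchwarz _ _) _.
  by rewrite (orthonormal_norm _ direction_orthonormal) mulr1.
apply: le_trans (ler_normD _ _) _; have := h (inl j); have := h (inr j).
by rewrite /=; lra.
Qed.

(** Absolute convergence: by [opA_term_le] the terms are dominated by a multiple of [eps]. The [+ 1]
    in the denominator covers [X = 0]; the same device recurs with other constants that may
    vanish. *)
Lemma opA_cvg (X : K) :
  cvg (summability.partial_sum (opA_term e eps X) @ summability.totally).
Proof.
have FF := summability.totally_filter (I := Gamma).
apply/cauchy_cvgP/cauchyP => r r0.
have r'0 : 0 < r / (2 * `|X| + 1).
  by rewrite divr_gt0// ltr_wpDl// mulr_ge0.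
have [s0 us0 h] := bounded_sums_tail eps_sum r'0.
exists (summability.partial_sum (opA_term e eps X) [fset j in s0]%fset).
exists [fset j in s0]%fset => // J /= s0J.
rewrite -ball_normE/= !partial_sumE distrC.
rewrite (big_fsetID _ (fun j => j \in [fset j in s0]%fset) J)/=.
have -> : [fset x | x in J & x \in [fset j in s0]]%fset = [fset j in s0]%fset.
  apply/fsetP => j; rewrite !inE; apply/andP/idP => [[]//|js].
  by split=> //; apply: (fsubsetP s0J); rewrite inE.
rewrite addrAC subrr add0r; apply: le_lt_trans (ler_norm_sum _ _ _) _.
apply: (@le_lt_trans _ _ (\sum_(j <- [fset x | x in J & x \notin
  [fset j in s0]]%fset) 2 * `|X| * eps j)).
  by apply: ler_sum => j _; exact: opA_term_le.
rewrite -mulr_sumr; set t := \sum_(_ <- _) _.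
have : t < r / (2 * `|X| + 1).
  by apply: h; [exact: fset_uniq|move=> i; rewrite !inE => /andP[]].
rewrite ltr_pdivlMr ?ltr_wpDl ?mulr_ge0//; apply: le_lt_trans.
rewrite mulrC ler_wpM2l// ?lerDl// sumr_ge0// => j _.
exact/ltW/eps_gt0.
Qed.

Lemma cvg_dotp (T : Type) (F : set_system T) (FF : Filter F) (f : T -> K) x y :
  f @ F --> x -> (fun t => dotp (f t) y) @ F --> dotp x y.
Proof.
move=> /cvgrPdist_lt fx; apply/cvgrPdist_lt => r r0.
have r'0 : 0 < r / (`|y| + 1) by rewrite divr_gt0// ltr_wpDl.
apply: filterS (fx _ r'0) => t; rewrite ltr_pdivlMr ?ltr_wpDl// -dotpBl.
apply: le_lt_trans; apply: le_trans (CauchySchwarz _ _) _.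
by rewrite ler_wpM2l// lerDl.
Qed.

(** Continuity of the inner product reduces the vector-valued sum to real sums. Symmetry and the
    comparison of the form with finite sums are read off from this limit. *)
Lemma opA_form_cvg (X Y : K) :
  (fun J : {fset Gamma} => \sum_(d <- both J) weight d * (dotp X (g d) * dotp Y (g d)))
    @ summability.totally --> dotp (A X) Y.
Proof.
have FF := summability.totally_filter (I := Gamma).
rewrite (_ : (fun J => _) =
  fun J : {fset Gamma} => dotp (summability.partial_sum (opA_term e eps X) J) Y).
  by apply: cvg_dotp; exact: opA_cvg.
by apply/funext => J; rewrite partial_sumE opA_term_both.
Qed.

Lemma opA_sym : symmetric_op A.
Proof.
have FF := summability.totally_filter (I := Gamma).
move=> X Y; rewrite (dotpC X).
have h1 := @opA_form_cvg X Y; have := @opA_form_cvg Y X.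
under eq_fun do under eq_bigr do rewrite [dotp Y _ * _]mulrC.
move=> h2; exact: (cvg_unique _ h1 h2).
Qed.

Lemma opA_linear : linear A.
Proof.
have FF := summability.totally_filter (I := Gamma).
move=> a X Y.
have h : summability.partial_sum (opA_term e eps (a *: X + Y)) =
    a *: summability.partial_sum (opA_term e eps X) +
    summability.partial_sum (opA_term e eps Y).
  apply/funext => J; rewrite !fctE !partial_sumE scaler_sumr -big_split/=.
  apply: eq_bigr => j _; rewrite /opA_term !dotpDl !dotpZl scalerDr !scalerA.
  by rewrite [RHS]addrACA -!scalerDl; congr (_ *: _ + _ *: _); ring.
apply: (cvg_lim (@norm_hausdorff _ _)); rewrite h.
by apply: cvgD; [apply: cvgZl_tmp|]; exact: opA_cvg.
Qed.

Lemma qsum_le s X : uniq s -> qsum g weight s X <= dotp (A X) X.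
Proof.
have FF := summability.totally_filter (I := Gamma).
move=> us; have h := @opA_form_cvg X X.
apply: (closed_cvg _ (@closed_ge _ (qsum g weight s X)) _ _ h) => //=.
(* [J0] forgets on which side of [Gamma + Gamma] an index lies; as soon as [J] contains [J0], the
   list [both J] contains [s]. *)
pose J0 : {fset Gamma} := [fset (match d with inl j | inr j => j end) | d in s]%fset.
exists J0 => // J /= J0J; rewrite /qsum.
under [leRHS]eq_bigr do rewrite -expr2.
apply: ler_sum_subset => //.
- by move=> d; rewrite mulr_ge0 ?sqr_ge0 ?(ltW (weight_gt0 _)).
- by apply: both_uniq; exact: fset_uniq.
- move=> d ds; rewrite mem_cat.
  have /(fsubsetP J0J) : (match d with inl j | inr j => j end) \in J0.
    by apply/imfsetP; exists d.
  by case: d {ds} => j jJ; rewrite map_f ?orbT.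
Qed.

Lemma opA_form_ub X c : (forall s, uniq s -> qsum g weight s X <= c) ->
  dotp (A X) X <= c.
Proof.
have FF := summability.totally_filter (I := Gamma).
move=> Xc; have h := @opA_form_cvg X X.
apply: (closed_cvg _ (@closed_le _ c) _ _ h) => //=.
exists fset0 => // J _ /=; under eq_bigr do rewrite -expr2.
by apply: Xc; apply: both_uniq; exact: fset_uniq.
Qed.

Lemma opA_diagonal : diagonal_form g weight A.
Proof.
split.
- exact: direction_orthonormal.
- exact: direction_total.
- exact: weight_gt0.
- exact: weight_bounded.
- exact: opA_linear.
- exact: opA_sym.
- exact: qsum_le.
- exact: opA_form_ub.
Qed.

End diagonal_operator.

Section diagonal_form_theory.
Context (R : realType) (K : hilbertType R) (D : eqType).
Context (g : D -> K) (ep : D -> R) (T : K -> K).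
Hypothesis TD : diagonal_form g ep T.
Local Notation q X := (dotp (T X) X).
Local Notation qsum := (qsum g ep).

Lemma qsum_ge0 s X : 0 <= qsum s X.
Proof.
by rewrite sumr_ge0// => d _; rewrite mulr_ge0 ?sqr_ge0// ltW// (diag_gt0 TD).
Qed.

Lemma diag_ge0 X : 0 <= q X.
Proof. exact: le_trans (qsum_ge0 [::] X) (diag_le TD _ _). Qed.

(** If the form vanishes at [X], so does every one-term sum; then [X] is orthogonal to all [g d],
    and totality concludes. *)
Lemma diag_pos X : X != 0 -> 0 < q X.
Proof.
move=> X_neq0; rewrite lt_neqAle diag_ge0 andbT.
apply: contraNneq X_neq0 => q0.
apply/eqP; apply: (total_family_eq0 (diag_total TD)) => d.
have := @diag_le _ _ _ _ _ _ TD [:: d] X isT; rewrite -q0 /qsum big_seq1.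
rewrite pmulr_rle0 ?(diag_gt0 TD)// => h; apply/eqP.
by rewrite -sqrf_eq0 eq_le h sqr_ge0.
Qed.

Lemma diag_norm : is_norm (fun X => Num.sqrt (q X)).
Proof.
split.
- exact: (sqrt_formD (diag_linear TD) (diag_sym TD) diag_ge0).
- by move=> a X; exact: (sqrt_formZ (diag_linear TD)).
- move=> X /eqP; rewrite sqrtr_eq0 => qX; apply/eqP; apply: contraTT qX.
  by rewrite -ltNge; exact: diag_pos.
Qed.

Lemma diag_bound : exists2 C, 0 <= C & forall X, q X <= C * `|X| ^+ 2.
Proof.
have [C hC] := diag_bounded TD; exists C; first by have := hC [::] isT; rewrite big_nil.
move=> X; apply: (diag_ub TD) => s us.
apply: (le_trans _ (ler_wpM2r (sqr_ge0 _) (hC s us))).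
rewrite mulr_suml; apply: ler_sum => d _; rewrite ler_wpM2l ?(ltW (diag_gt0 TD d))//.
by have := Bessel (diag_orthonormal TD) X (s := [:: d]) isT; rewrite big_seq1.
Qed.

(** Cauchy-Schwarz for the form at [X] and [T X] bounds the fourth power of the norm of [T X] by
    [q X * q (T X)], and [diag_bound] controls both factors. *)
Lemma diag_op_bound : exists2 C, 0 <= C & forall X, `|T X| <= C * `|X|.
Proof.
have [C C0 hC] := diag_bound; exists C => // X.
have := form_CauchySchwarz (diag_linear TD) (diag_sym TD) diag_ge0 X (T X).
have [->|TX0] := eqVneq (`|T X|) 0; first by rewrite mulr_ge0.
have {}TX0 : 0 < `|T X| by rewrite lt_neqAle eq_sym TX0 normr_ge0.
move=> h; have : `|T X| ^+ 2 ^+ 2 <= (C * `|X| * `|T X|) ^+ 2.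
  rewrite -dotpxx (le_trans h)//.
  apply: le_trans (ler_pM (diag_ge0 _) (diag_ge0 _) (hC _) (hC _)) _.
  by rewrite le_eqVlt; apply/orP; left; apply/eqP; ring.
rewrite ler_pXn2r ?nnegrE ?sqr_ge0 ?mulr_ge0//.
by rewrite expr2 ler_pM2r.
Qed.

Lemma diag_continuous : continuous T.
Proof.
have [C C0 hC] := diag_op_bound.
move=> X; apply/cvgrPdist_lt => r r0.
have d0 : 0 < r / (C + 1) by rewrite divr_gt0// ltr_wpDl.
near=> Y; rewrite (_ : T X - T Y = T (X - Y)); last first.
  have T_lin := diag_linear TD.
  by rewrite (linearopD T_lin) -scaleN1r -(linearopZ T_lin) scaleN1r.
apply: le_lt_trans (hC _) _.
have : `|X - Y| < r / (C + 1) by near: Y; exact: cvgr_dist_lt.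
rewrite ltr_pdivlMr ?ltr_wpDl// mulrC; apply: le_lt_trans.
by rewrite ler_wpM2r// lerDl.
Unshelve. all: by end_near. Qed.

(** One list [t] serves all the vectors: [qsum] grows with the list, so the lists found for the head
    and the tail of [s] can be merged. The infinite sums hidden in the form thereby become finite
    and can be exchanged with the sum over [s]. *)
Lemma diag_approx (I : Type) (w : I -> K) (s : seq I) (delta : R) : 0 < delta ->
  exists2 t, uniq t &
    \sum_(i <- s) q (w i) <= \sum_(i <- s) qsum t (w i) + delta.
Proof.
elim: s delta => [|i s IH] delta d0.
  by exists [::] => //; rewrite !big_nil add0r ltW.
have d20 : 0 < delta / 2 by rewrite divr_gt0.
have [t ut ht] := IH _ d20.
have [t' [ut' ht']] : exists t', uniq t' /\ q (w i) < qsum t' (w i) + delta / 2.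
  apply: contrapT => /forallNP h.
  have : q (w i) <= q (w i) - delta / 2.
    apply: (diag_ub TD) => t' ut'; have /not_andP[//|/negP] := h t'.
    by rewrite -leNgt; lra.
  by lra.
have u : uniq (undup (t ++ t')) by exact: undup_uniq.
have ge0 X d : 0 <= ep d * dotp X (g d) ^+ 2.
  by rewrite mulr_ge0 ?sqr_ge0 ?(ltW (diag_gt0 TD d)).
exists (undup (t ++ t')) => //; rewrite !big_cons.
have : qsum t' (w i) <= qsum (undup (t ++ t')) (w i).
  by apply: ler_sum_subset => // d dt; rewrite mem_undup mem_cat dt orbT.
suff : \sum_(i <- s) qsum t (w i) <= \sum_(i <- s) qsum (undup (t ++ t')) (w i).
  by lra.
apply: ler_sum => j _; apply: ler_sum_subset => // d dt.
by rewrite mem_undup mem_cat dt.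
Qed.

(* The bound on [\sum_i q (w i)] by a trace: the double sum is exchanged and
   Bessel's inequality is applied in the variable [i]. *)
Lemma diag_sum_le (I : eqType) (w : I -> K) (s : seq I) c :
  orthonormal_family w -> uniq s ->
  (forall t, uniq t ->
     \sum_(d <- t | has (fun i => dotp (w i) (g d) != 0) s) ep d <= c) ->
  \sum_(i <- s) q (w i) <= c.
Proof.
move=> ow us hc; apply/ler_addgt0Pr => delta d0.
have [t ut /le_trans] := diag_approx w s d0; apply; rewrite lerD2r.
apply: le_trans (hc t ut); rewrite exchange_big/= big_mkcond [leRHS]big_mkcond/=.
apply: ler_sum => d _; case: ifPn => [_|/hasPn h].
  rewrite -mulr_sumr -[leRHS]mulr1 ler_wpM2l ?(ltW (diag_gt0 TD d))//.
  have := Bessel ow (g d) us; rewrite (orthonormal_norm _ (diag_orthonormal TD)).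
  by rewrite expr1n; under eq_bigr do rewrite dotpC.
rewrite big_seq big1// => i /h; rewrite negbK => /eqP ->.
by rewrite expr0n mulr0.
Qed.

(** Being symmetric and nonnegative, [T] is its own absolute value; in any basis its trace is at
    most the common bound of the finite sums of weights. *)
Lemma diag_trace_class : trace_class T.
Proof.
have T_lin := diag_linear TD.
split=> //; first exact: diag_continuous.
exists T; first split=> //.
- exact: diag_continuous.
- exact: diag_sym TD.
- exact: diag_ge0.
- by move=> x y; rewrite (diag_sym TD).
move=> I f [of_ _]; have [C hC] := diag_bounded TD.
apply: (@le_lt_trans _ _ C%:E); last exact: ltry.
apply: ub_ereal_sup => _ [X [fX _] <-].
rewrite fsbig_finite//= sumEFin lee_fin.
apply: diag_sum_le => // [|t ut]; first exact: fset_uniq.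
apply: le_trans (hC t ut).
rewrite [leRHS](bigID (fun d => has (fun i => dotp (f i) (g d) != 0) (fset_set X)))/= lerDl.
by rewrite sumr_ge0// => d _; rewrite ltW// (diag_gt0 TD).
Qed.

End diagonal_form_theory.

(** * Gaussian integrals *)

Section density.
Context d (T : measurableType d) (R : realType).
Context (nu la : {measure set T -> \bar R}) (p : T -> R).
Hypotheses (p0 : forall x, 0 <= p x) (mp : measurable_fun setT p).
Hypothesis nuE : forall A, measurable A ->
  nu A = (\int[la]_(x in A) (p x)%:E)%E.
Import HBNNSimple.
Local Open Scope ereal_scope.

(** Simple functions and monotone convergence. Gaussian laws are specified by their values on sets,
    while the moments required are integrals. *)
Lemma ge0_integral_density (f : T -> \bar R) :
  (forall x, 0 <= f x) -> measurable_fun setT f ->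
  \int[nu]_x f x = \int[la]_x (f x * (p x)%:E).
Proof.
move=> f0 mf; pose h := nnsfun_approx measurableT mf.
have fE x : f x = lim ((h n x)%:E @[n --> \oo]).
  by apply/esym/cvg_lim => //; exact: cvg_nnsfun_approx.
have mEp : measurable_fun setT (EFin \o p) by exact/measurable_EFinP.
have nd_h x : nondecreasing_seq (fun n => (h n x)%:E).
  by move=> a b ab; rewrite lee_fin; exact/lefP/nd_nnsfun_approx.
have -> : \int[nu]_x f x = lim (\int[nu]_x (h n x)%:E @[n --> \oo]).
  under eq_integral => x _ do rewrite fE.
  apply: monotone_convergence => //.
  - by move=> n; exact/measurable_EFinP/measurable_funP.
  - by move=> n x _; rewrite lee_fin.
have -> : \int[la]_x (f x * (p x)%:E) =
    lim (\int[la]_x ((h n x)%:E * (p x)%:E) @[n --> \oo]).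
  have fg x : f x * (p x)%:E = lim ((h n x)%:E * (p x)%:E @[n --> \oo]).
    by apply/esym/cvg_lim => //; apply: cvgeZr => //; exact: cvg_nnsfun_approx.
  under eq_integral => x _ do rewrite fg.
  apply: monotone_convergence => //.
  - move=> n; apply/emeasurable_funM => //.
    exact/measurable_EFinP/measurable_funP.
  - by move=> n x _; rewrite mule_ge0 ?lee_fin.
  - by move=> x _ a b ab; rewrite lee_wpmul2r ?lee_fin//; exact/lefP/nd_nnsfun_approx.
congr (limn _); apply/funext => n.
have mh y : measurable_fun setT (fun x => (y * \1_(h n @^-1` [set y]) x)%:E).
  by apply/measurable_EFinP; exact: measurable_funM.
under eq_integral do rewrite fimfunE -fsumEFin//.
rewrite ge0_integral_fsum//; last by move=> y x _; exact: nnfun_muleindic_ge0.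
under [RHS]eq_integral => x _.
  rewrite fimfunE -fsumEFin// ge0_mule_fsuml; last first.
    by move=> y; exact: nnfun_muleindic_ge0.
  over.
rewrite ge0_integral_fsum//; last 2 first.
- by move=> y; exact: emeasurable_funM.
- by move=> y x _; rewrite mule_ge0 ?lee_fin// -lee_fin; exact: nnfun_muleindic_ge0.
apply: eq_fsbigr => y /[!inE] -[x0 _ hy].
have y0 : (0 <= y)%R by rewrite -hy.
under eq_integral do rewrite EFinM.
rewrite ge0_integralZl_EFin//; last exact/measurable_EFinP.
rewrite integral_indic// setIT nuE//.
under [RHS]eq_integral do rewrite EFinM -muleA.
rewrite ge0_integralZl_EFin//; last 2 first.
- by move=> x _; rewrite mule_ge0 ?lee_fin.
- by apply: emeasurable_funM => //; exact/measurable_EFinP.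
congr (_ * _); rewrite integral_mkcond; apply: eq_integral => x _.
rewrite patchE indicE; case: ifPn => _; first by rewrite mul1e.
by rewrite mul0e.
Qed.

End density.

Section image_measure.
Context d1 d2 (T1 : measurableType d1) (T2 : measurableType d2) (R : realType).
Context (mu : {measure set T1 -> \bar R}) (phi : T1 -> T2).
Hypothesis mphi : measurable_fun setT phi.
Local Open Scope ereal_scope.

Let image : {measure set T2 -> \bar R} :=
  measure_function_pushforward__canonical__measure_function_Measure mu mphi.

Lemma ge0_integral_image (nu : {measure set T2 -> \bar R}) (f : T2 -> \bar R) :
  (forall A, measurable A -> mu (phi @^-1` A) = nu A) ->
  (forall y, 0 <= f y) -> measurable_fun setT f ->
  \int[mu]_x f (phi x) = \int[nu]_y f y.
Proof.
move=> muE f0 mf; transitivity (\int[image]_y f y).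
  have E := ge0_integral_pushforward mphi mu measurableT mf (fun x _ => f0 x).
  exact/esym/E.
have M A : measurable A -> A `<=` setT -> image A = nu A by move=> /muE.
exact: (@eq_measure_integral _ _ _ _ nu image f M).
Qed.

Lemma ge0_integral_image_density (la : {measure set T2 -> \bar R})
    (p : T2 -> R) (f : T2 -> \bar R) :
  (forall y, 0 <= p y)%R -> measurable_fun setT p ->
  (forall A, measurable A -> mu (phi @^-1` A) = \int[la]_(y in A) (p y)%:E) ->
  (forall y, 0 <= f y) -> measurable_fun setT f ->
  \int[mu]_x f (phi x) = \int[la]_y (f y * (p y)%:E).
Proof.
move=> p0 mp muE f0 mf; rewrite -(@ge0_integral_density _ _ _ image la)//.
exact: ge0_integral_image.
Qed.

End image_measure.

Section lebesgue_tuple_fubini.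
Context (R : realType).
Local Notation T := (measurableTypeR R).
Local Notation leb := (@lebesgue_measure R).
Local Open Scope ereal_scope.

Let tcons n (x : T * n.-tuple T) : n.+1.-tuple T := [tuple of x.1 :: x.2].

Let measurable_tcons n : measurable_fun setT (@tcons n).
Proof. exact: measurable_cons. Qed.

(** By construction the measure is the image of a product measure under consing, so this is
    Tonelli's theorem. *)
Lemma integral_lebesgue_tupleS n (f : n.+1.-tuple T -> \bar R) :
  (forall v, 0 <= f v) -> measurable_fun setT f ->
  \int[lebesgue_tuple R n.+1]_v f v =
  \int[leb]_t \int[lebesgue_tuple R n]_v f [tuple of t :: v].
Proof.
move=> f0 mf; transitivity (\int[pushforward (leb \x lebesgue_tuple R n) (@tcons n)]_v f v).
  by [].
rewrite ge0_integral_pushforward//; last exact: measurable_tcons.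
rewrite fubini_tonelli1//; last by move=> x /=.
exact: (measurableT_comp mf (@measurable_tcons n)).
Qed.

Lemma measurable_integral_tuple n (f : n.+1.-tuple T -> \bar R) :
  (forall v, 0 <= f v) -> measurable_fun setT f ->
  measurable_fun setT (fun t : T => \int[lebesgue_tuple R n]_v f [tuple of t :: v]).
Proof.
move=> f0 mf.
have := @measurable_fun_fubini_tonelli_F _ _ _ _ R (lebesgue_tuple R n) (f \o @tcons n).
apply; last by move=> x /=.
exact: (measurableT_comp mf (@measurable_tcons n)).
Qed.

Lemma integral_lebesgue_tuple0 (f : 0.-tuple T -> \bar R) :
  measurable_fun setT f -> \int[lebesgue_tuple R 0]_v f v = f [tuple].
Proof.
move=> mf; rewrite /= integral_dirac//.
by rewrite diracE in_setT mul1e.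
Qed.

Lemma ge0_integral_reflect (f : T -> \bar R) :
  (forall t, 0 <= f t) -> measurable_fun setT f ->
  \int[leb]_t f (- (t : R))%R = \int[leb]_t f t.
Proof.
move=> f0 mf; pose o : T -> T := (-%R : R -> T).
have mopp : measurable_fun setT o by exact: measurable_funN.
apply: (ge0_integral_image mopp) => // A mA.
exact: lebesgue_measureN.
Qed.

(** Doubling the integral avoids a division by 2 of values that may be infinite; [eadd_double_inj]
    cancels the doubling afterwards. *)
Lemma ge0_integral_symmetrize (f : T -> \bar R) :
  (forall t, 0 <= f t) -> measurable_fun setT f ->
  \int[leb]_t f t + \int[leb]_t f t = \int[leb]_t (f t + f (- (t : R))%R).
Proof.
move=> f0 mf; rewrite ge0_integralD//; last first.
  have mopp : measurable_fun setT (-%R : R -> T) by exact: measurable_funN.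
  exact: (measurableT_comp mf mopp).
by congr (_ + _); rewrite ge0_integral_reflect.
Qed.

End lebesgue_tuple_fubini.

Section gaussian_moments.
Context (R : realType) (h : R) (h0 : 0 < h).
Local Notation T := (measurableTypeR R).
Local Notation leb := (@lebesgue_measure R).
Local Notation phi := (normal_pdf 0 (Num.sqrt h)).

Lemma gauss_pdf_ge0 n v : 0 <= @gauss_pdf R n h v.
Proof. by rewrite mulr_ge0 ?powR_ge0 ?expR_ge0. Qed.

Lemma measurable_gauss_pdf n : measurable_fun setT (@gauss_pdf R n h).
Proof.
apply: measurable_funM => //; apply: measurableT_comp => //.
apply: measurable_funM => //; apply: measurableT_comp => //.
apply: measurable_sum => i; apply: measurable_funX; exact: measurable_tnth.
Qed.

Let sqrth_neq0 : Num.sqrt h != 0. Proof. by rewrite gt_eqF ?sqrtr_gt0. Qed.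

Lemma gauss_pdfS n (t : T) (v : n.-tuple T) :
  gauss_pdf h [tuple of t :: v] = phi t * gauss_pdf h v.
Proof.
rewrite normal_pdfE// /gauss_pdf /normal_peak /normal_fun.
rewrite sqr_sqrtr ?ltW// big_ord_recl tnth0.
under eq_bigr do rewrite tnthS.
have pih : 0 < 2 * pi * h by rewrite !mulr_gt0 ?pi_gt0.
rewrite mulrACA -expRD subr0; congr (_ * expR _); last first.
  by rewrite -(mulr_natl h) opprD mulrDl.
rewrite (_ : - (n.+1%:R / 2) = - 2^-1 + - (n%:R / 2)); last first.
  by rewrite -natr1; field.
rewrite powRD; last by rewrite (gt_eqF pih) implybT.
congr (_ * _); rewrite powRN powR12_sqrt ?ltW//; congr (Num.sqrt _)^-1.
by rewrite -mulr_natl; ring.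
Qed.

Lemma integral_gauss_pdf n :
  (\int[lebesgue_tuple R n]_v (gauss_pdf h v)%:E = 1)%E.
Proof.
have mp m : measurable_fun setT (fun v => (@gauss_pdf R m h v)%:E).
  by apply/measurable_EFinP; exact: measurable_gauss_pdf.
elim: n => [|n IH].
  rewrite integral_lebesgue_tuple0// /gauss_pdf big_ord0 mul0r oppr0 powRr0.
  by rewrite mul0r expR0 mul1r.
rewrite integral_lebesgue_tupleS//; last first.
  by move=> v; rewrite lee_fin gauss_pdf_ge0.
rewrite -[RHS](integral_normal_pdf 0 (Num.sqrt h)).
apply: eq_integral => t _; under eq_integral do rewrite gauss_pdfS EFinM.
rewrite ge0_integralZl_EFin//; last 3 first.
- by move=> v _; rewrite lee_fin gauss_pdf_ge0.
- exact: mp.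
- exact: normal_pdf_ge0.
by rewrite IH mule1.
Qed.

Definition gauss_moment2 : \bar R := (\int[leb]_t (t ^+ 2 * phi t)%:E)%E.

Lemma gauss_moment2_ge0 : (0 <= gauss_moment2)%E.
Proof.
by apply: integral_ge0 => t _; rewrite lee_fin mulr_ge0 ?sqr_ge0 ?normal_pdf_ge0.
Qed.

(* [t ^+ 2 <= 4 * h * expR (t ^+ 2 / (4 * h))] trades the square for a Gaussian
   density of doubled variance. *)
Lemma gauss_moment2_lty : (gauss_moment2 < +oo)%E.
Proof.
have s2 : Num.sqrt (2 * h) != 0 by rewrite gt_eqF// sqrtr_gt0 mulr_gt0.
pose c := 4 * h * normal_peak (Num.sqrt h) / normal_peak (Num.sqrt (2 * h)).
have pk0 : 0 < normal_peak (Num.sqrt (2 * h)) by rewrite normal_peak_gt0.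
have c0 : 0 <= c by rewrite /c divr_ge0 ?mulr_ge0 ?normal_peak_ge0 ?(ltW h0).
apply: (@le_lt_trans _ _ (\int[leb]_t (c%:E * (normal_pdf 0 (Num.sqrt (2 * h)) t)%:E)))%E.
  apply: ge0_le_integral => //.
  - by move=> t _; rewrite lee_fin mulr_ge0 ?sqr_ge0 ?normal_pdf_ge0.
  - apply/measurable_EFinP/measurable_funM; first exact: measurable_funX.
    exact: measurable_normal_pdf.
  - apply: measurable_funeM; apply/measurable_EFinP.
    exact: measurable_normal_pdf.
  - move=> t _; rewrite -EFinM lee_fin !normal_pdfE// /normal_fun.
    rewrite !subr0 !sqr_sqrtr ?mulr_ge0 ?(ltW h0)//.
    rewrite /c [leRHS]mulrA divfK ?gt_eqF// mulrCA -mulrA.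
    rewrite [leRHS](_ : _ = normal_peak (Num.sqrt h) *
      (4 * h * expR (- t ^+ 2 / (2 * h *+ 2)))); last by ring.
    rewrite ler_wpM2l ?normal_peak_ge0//.
    rewrite (_ : - t ^+ 2 / (h *+ 2) =
      - t ^+ 2 / (2 * h *+ 2) + - t ^+ 2 / (2 * h *+ 2)); last first.
      by field; rewrite gt_eqF.
    rewrite expRD mulrA ler_wpM2r ?expR_ge0//.
    rewrite mulNr expRN ler_pdivrMr ?expR_gt0//.
    rewrite -ler_pdivrMl ?mulr_gt0//.
    apply: le_trans (expR_ge1Dx _); rewrite -[leLHS]add0r lerD//.
    by rewrite le_eqVlt; apply/orP; left; apply/eqP; field; rewrite gt_eqF.
rewrite ge0_integralZl_EFin//; last 2 first.
- by move=> t _; rewrite lee_fin normal_pdf_ge0.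
- by apply/measurable_EFinP; exact: measurable_normal_pdf.
by rewrite integral_normal_pdf mule1 ltry.
Qed.

Section forms.
Context (K : hilbertType R) (A : K -> K).
Hypotheses (A_lin : linear A) (A_sym : symmetric_op A).
Hypothesis A_ge0 : forall x, 0 <= dotp (A x) x.
Local Notation q X := (dotp (A X) X).
Local Notation comb v w := (\sum_i (tnth v i : R) *: w i).

Lemma measurable_form d (X : measurableType d) n (f : 'I_n -> X -> R)
    (w : 'I_n -> K) :
  (forall i, measurable_fun setT (f i)) ->
  measurable_fun setT (fun x => q (\sum_i f i x *: w i)).
Proof.
move=> mf.
have -> : (fun x => q (\sum_i f i x *: w i)) =
    (fun x => \sum_i f i x * \sum_j f j x * dotp (A (w i)) (w j)).
  apply/funext => x; rewrite A_sym dotp_suml; apply: eq_bigr => i _.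
  rewrite dotpZl -A_sym dotp_sumr; congr (_ * _).
  by apply: eq_bigr => j _; rewrite dotpZr.
apply: measurable_sum => i; apply: measurable_funM => //.
by apply: measurable_sum => j; exact: measurable_funM.
Qed.

Lemma measurable_form_tuple n (w : 'I_n -> K) :
  measurable_fun setT (fun v : n.-tuple T => q (comb v w)).
Proof. by apply: measurable_form => i; exact: measurable_tnth. Qed.

Let eadd_double_inj (x y : \bar R) : (0 <= x)%E -> (0 <= y)%E ->
  (x + x = y + y)%E -> x = y.
Proof.
move: x y => [x| |] [y| |]//= x0 y0 [xy]; congr EFin.
by lra.
Qed.

(* Replacing the first coordinate [t] by [- t] leaves the integral unchanged and,
   by the parallelogram identity, cancels the cross terms. *)
Lemma integral_gauss_form n (w : 'I_n -> K) :
  (\int[lebesgue_tuple R n]_v (q (comb v w) * gauss_pdf h v)%:E =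
   gauss_moment2 * (\sum_i q (w i))%:E)%E.
Proof.
have mf m (u : 'I_m -> K) : measurable_fun setT
    (fun v : m.-tuple T => (q (comb v u) * gauss_pdf h v)%:E).
  apply/measurable_EFinP/measurable_funM; first exact: measurable_form_tuple.
  exact: measurable_gauss_pdf.
have f0 m (u : 'I_m -> K) (v : m.-tuple T) :
    (0 <= (q (comb v u) * gauss_pdf h v)%:E)%E.
  by rewrite lee_fin mulr_ge0 ?gauss_pdf_ge0.
elim: n w => [|n IH] w.
  rewrite integral_lebesgue_tuple0//= !big_ord0 mule0.
  by rewrite dotp0r mul0r.
pose y (v : n.-tuple T) := comb v (fun i => w (lift ord0 i)).
have combE t (v : n.-tuple T) : comb [tuple of t :: v] w = t *: w ord0 + y v.
  rewrite big_ord_recl tnth0; congr +%R.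
  by apply: eq_bigr => i _; rewrite tnthS.
apply: eadd_double_inj.
- exact: integral_ge0.
- by rewrite mule_ge0 ?gauss_moment2_ge0// lee_fin sumr_ge0.
have S0 : 0 <= \sum_i q (w (lift ord0 i)) by rewrite sumr_ge0.
rewrite integral_lebesgue_tupleS//.
pose G (t : T) := (\int[lebesgue_tuple R n]_v
  (q (comb [tuple of t :: v] w) * gauss_pdf h [tuple of t :: v])%:E)%E.
rewrite -/(G _).
have mG : measurable_fun setT G.
  by apply: (measurable_integral_tuple (f := fun v => (q (comb v w) * gauss_pdf h v)%:E)).
have G0 t : (0 <= G t)%E by rewrite /G; apply: integral_ge0 => v _; exact: f0.
rewrite (ge0_integral_symmetrize G0 mG).
have q2_ge0 : 0 <= 2 * q (w ord0) by rewrite mulr_ge0.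
have tphi0 t : 0 <= t ^+ 2 * phi t.
  by apply: mulr_ge0; [exact: sqr_ge0|exact: normal_pdf_ge0].
have mtcons (t : T) : measurable_fun setT (fun v : n.-tuple T => [tuple of t :: v]).
  by apply: measurable_cons.
transitivity (\int[leb]_t ((2 * q (w ord0))%:E * (t ^+ 2 * phi t)%:E +
    (2%:E * (gauss_moment2 * (\sum_i q (w (lift ord0 i)))%:E)) * (phi t)%:E))%E.
  apply: eq_integral => t _.
  rewrite -ge0_integralD//; last 2 first.
  - by apply: (measurableT_comp (mf _ _)).
  - by apply: (measurableT_comp (mf _ _)).
  transitivity (\int[lebesgue_tuple R n]_v
     ((2 * q (w ord0) * (t ^+ 2 * phi t))%:E * (gauss_pdf h v)%:E +
      (2 * phi t)%:E * (q (y v) * gauss_pdf h v)%:E))%E.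
    apply: eq_integral => v _; rewrite !combE !gauss_pdfS -EFinD -!EFinM -EFinD.
    congr EFin; rewrite !formD// !formZ// !linearopZ// !dotpZl.
    rewrite [phi (- t)](_ : _ = phi t); first by ring.
    by rewrite !normal_pdfE// /normal_fun !subr0 sqrrN.
  have phi0 : 0 <= phi t by exact: normal_pdf_ge0.
  rewrite ge0_integralD//=; last 4 first.
  - move=> v _; rewrite -EFinM lee_fin mulr_ge0 ?gauss_pdf_ge0//.
    by apply: mulr_ge0; apply: mulr_ge0 => //; exact: sqr_ge0.
  - apply: measurable_funeM; apply/measurable_EFinP; exact: measurable_gauss_pdf.
  - move=> v _; rewrite -EFinM lee_fin mulr_ge0//; apply: mulr_ge0 => //.
    exact: gauss_pdf_ge0.
  - by apply: measurable_funeM; exact: mf.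
  rewrite ge0_integralZl_EFin//; last 3 first.
  - by move=> v _; rewrite lee_fin gauss_pdf_ge0.
  - apply/measurable_EFinP; exact: measurable_gauss_pdf.
  - by apply: mulr_ge0; apply: mulr_ge0 => //; exact: sqr_ge0.
  rewrite ge0_integralZl_EFin//; last 3 first.
  - by move=> v _; exact: f0.
  - exact: mf.
  - by rewrite mulr_ge0.
  rewrite integral_gauss_pdf mule1 IH EFinM; congr (_ + _)%E.
  by rewrite EFinM muleAC.
rewrite ge0_integralD//=; last 4 first.
- by move=> t _; rewrite mule_ge0 ?lee_fin ?tphi0 ?q2_ge0.
- apply: measurable_funeM; apply/measurable_EFinP/measurable_funM.
    exact: measurable_funX.
  exact: measurable_normal_pdf.
- move=> v _; rewrite !mule_ge0 ?gauss_moment2_ge0 ?lee_fin//.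
  exact: normal_pdf_ge0.
- apply: measurable_funeM; apply/measurable_EFinP; exact: measurable_normal_pdf.
rewrite ge0_integralZl_EFin//; last 2 first.
- by move=> t _; rewrite lee_fin.
- apply/measurable_EFinP/measurable_funM; first exact: measurable_funX.
  exact: measurable_normal_pdf.
rewrite ge0_integralZl//; last 3 first.
- apply/measurable_EFinP; exact: measurable_normal_pdf.
- by move=> t _; rewrite lee_fin normal_pdf_ge0.
- by rewrite !mule_ge0 ?gauss_moment2_ge0 ?lee_fin.
rewrite integral_normal_pdf mule1 big_ord_recl.
rewrite -/gauss_moment2.
(* Finiteness of the moment turns an identity between extended reals into one between reals. *)
have := gauss_moment2_ge0; have := gauss_moment2_lty.
case: gauss_moment2 => // c _ _; rewrite -!EFinM -!EFinD; congr EFin.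
by ring.
Qed.

End forms.

End gaussian_moments.

(** * Measurability of the norm *)

Section gross_measurability.
Context (R : realType) (K : hilbertType R) (D : choiceType).
Context (g : D -> K) (ep : D -> R) (T : K -> K).
Hypothesis TD : diagonal_form g ep T.
Local Notation q X := (dotp (T X) X).

Lemma orthonormal_tnth (s : seq D) : uniq s ->
  orthonormal_family (fun i : 'I_(size s) => g (tnth (in_tuple s) i)).
Proof.
move=> us i j; rewrite (diag_orthonormal TD); congr (_%:R).
by congr nat_of_bool; apply: inj_eq; exact/tuple_uniqP.
Qed.

Lemma orthoproj_id n (w : 'I_n -> K) i : orthonormal_family w ->
  orthoproj w (w i) = w i.
Proof.
move=> ow; rewrite /orthoproj (bigD1 i)//= ow eqxx scale1r big1 ?addr0//.
by move=> j ji; rewrite ow eq_sym (negPf ji) scale0r.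
Qed.

Lemma gauss_Chebyshev n (w : 'I_n -> K) (eta : R) : 0 < eta ->
  (std_gauss_range w [set x | (eta < Num.sqrt (q x))%R] <=
   (eta ^- 2)%:E * (gauss_moment2 1 * (\sum_i q (w i))%:E))%E.
Proof.
move=> eta0; rewrite /std_gauss_range /gauss /=.
set S := [set v : n.-tuple _ | _].
have q0 := diag_ge0 TD.
have mq := measurable_form_tuple (diag_sym TD) w.
have e2 : 0 <= eta ^- 2 by rewrite invr_ge0 sqr_ge0.
have mS : measurable S.
  rewrite (_ : S = setT `&`
      (fun v => q (\sum_i (tnth v i : R) *: w i)) @^-1` `]eta ^+ 2, +oo[).
    exact: mq.
  apply/seteqP; split=> v /=; rewrite in_itv/= andbT.
    move=> h; split=> //; rewrite -(sqr_sqrtr (q0 _)) ltr_pXn2r// nnegrE ?sqrtr_ge0//.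
    exact: ltW.
  move=> [_]; rewrite -{1}(sqr_sqrtr (q0 _)) ltr_pXn2r// nnegrE ?sqrtr_ge0//.
  exact: ltW.
have mp := @measurable_gauss_pdf R 1 n.
have mqp : measurable_fun setT
    (fun v : n.-tuple _ => (q (\sum_i (tnth v i : R) *: w i) * gauss_pdf 1 v)%:E).
  by apply/measurable_EFinP/measurable_funM.
have qp0 (v : n.-tuple (measurableTypeR R)) :
    (0 <= (q (\sum_i (tnth v i : R) *: w i) * gauss_pdf 1 v)%:E)%E.
  by rewrite lee_fin mulr_ge0// gauss_pdf_ge0.
rewrite -(integral_gauss_form ltr01 (diag_linear TD) (diag_sym TD) q0).
rewrite -ge0_integralZl_EFin//.
apply: (@le_trans _ _ (\int[lebesgue_tuple R n]_(v in S) ((eta ^- 2)%:E *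
   (q (\sum_i (tnth v i : R) *: w i) * gauss_pdf 1 v)%:E))%E).
  apply: ge0_le_integral => //.
  - by move=> v _; rewrite lee_fin gauss_pdf_ge0.
  - exact/measurable_EFinP/measurable_funTS.
  - by apply: measurable_funeM; exact: measurable_funTS.
  - move=> v Sv; rewrite -EFinM lee_fin mulrA ler_peMl ?gauss_pdf_ge0//.
    rewrite ler_pdivlMl ?exprn_gt0// mulr1 -(sqr_sqrtr (q0 _)).
    by rewrite ler_pXn2r// ?nnegrE ?sqrtr_ge0 ?ltW.
apply: ge0_subset_integral => //.
- by apply: measurable_funeM.
- by move=> v _; rewrite mule_ge0.
Qed.

Lemma diag_measurable_norm : measurable_norm (fun X => Num.sqrt (q X)).
Proof.
split=> [|eta eta0]; first exact: diag_norm TD.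
have [c c0 cE] : exists2 c : R, 0 <= c & gauss_moment2 1 = c%:E.
  have := @gauss_moment2_ge0 R 1; have := @gauss_moment2_lty R 1 ltr01.
  by case: gauss_moment2 => // c _ c0; exists c.
(* Chebyshev's inequality divides the trace by [eta ^+ 2], and the result must stay below [eta]:
   hence the cube. *)
have d0 : 0 < eta ^+ 3 / (c + 1) by rewrite divr_gt0 ?exprn_gt0 ?ltr_wpDl.
have [s0 us0 hs0] := bounded_sums_tail (diag_bounded TD) d0.
exists (size s0), (fun i => g (tnth (in_tuple s0) i)).
have ow0 := orthonormal_tnth us0; split=> // n w ow ww0.
(* Both vectors are fixed by their own projections, so that orthogonality of the ranges applies to
   them. *)
have w_s0 i d : d \in s0 -> dotp (w i) (g d) = 0.
  move=> ds; have /tnthP[j dj] : d \in in_tuple s0 by [].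
  by have := ww0 (w i) (g d); rewrite (orthoproj_id i ow) dj (orthoproj_id j ow0).
apply: le_lt_trans (gauss_Chebyshev _ eta0) _; rewrite cE -!EFinM lte_fin.
(* By [w_s0], only weights outside [s0] remain in the bound of the trace. *)
have hq : \sum_i q (w i) <= eta ^+ 3 / (c + 1).
  apply: (diag_sum_le TD ow (index_enum_uniq _)) => t ut.
  rewrite -big_filter ltW// hs0 ?filter_uniq// => d.
  rewrite mem_filter => /andP[/hasP[i _ +] _]; apply: contra => /w_s0 ->.
  by rewrite eqxx.
rewrite -ltr_pdivlMl ?invr_gt0 ?exprn_gt0// invrK -exprSr.
apply: le_lt_trans (ler_wpM2l c0 hq) _.
by rewrite mulrCA gtr_pMr ?exprn_gt0// ltr_pdivrMr ?ltr_wpDl// mul1r ltrDl.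
Qed.

End gross_measurability.

(** * Lipschitz estimate for symbols *)

Section directional_lipschitz.
Context (R : realType) (K : hilbertType R) (D : eqType).
Context (g : D -> K) (ep : D -> R) (T : K -> K).
Hypothesis TD : diagonal_form g ep T.
Local Notation q X := (dotp (T X) X).
Context (f : K -> R) (M : R).
Hypotheses (f_cont : continuous f) (M0 : 0 <= M).
Hypothesis f_dir : forall d X t, `|f (X + t *: g d) - f X| <= M * ep d * `|t|.

Lemma lipschitz_comb (s : seq D) (c : D -> R) Y :
  `|f (Y + \sum_(d <- s) c d *: g d) - f Y| <=
  M * \sum_(d <- s) ep d * `|c d|.
Proof.
elim: s Y => [|d s IH] Y; first by rewrite !big_nil addr0 subrr normr0 mulr0.
rewrite !big_cons mulrDr addrA -(subrK (f (Y + c d *: g d)) (f (_ + _))) -addrA.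
rewrite [leRHS]addrC; apply: le_trans (ler_normD _ _) _; rewrite lerD//.
by rewrite mulrA.
Qed.

(** A displacement may have infinitely many coordinates. Replacing it by a finite projection costs
    less than an arbitrary [delta], by continuity of [f] at [X]; on the projection, weighted
    Cauchy-Schwarz with total weight at most [C] gives the constant [M * Num.sqrt C]. *)
Lemma diag_lipschitz : exists2 L, 0 <= L &
  forall X Y, `|f X - f Y| <= L * Num.sqrt (q (X - Y)).
Proof.
have ep0 d : 0 <= ep d by exact/ltW/(diag_gt0 TD).
have [C hC] := diag_bounded TD.
have C0 : 0 <= C by have := hC [::] isT; rewrite big_nil.
exists (M * Num.sqrt C); first by rewrite mulr_ge0 ?sqrtr_ge0.
move=> X Y; apply/ler_addgt0Pr => delta d0.
have /cvgrPdist_lt/(_ _ d0)/nbhs_ballP[r /= r0 hr] := @f_cont X.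
have [s us hs] := diag_total TD (X - Y) r0.
pose Z := proj_seq g s (X - Y).
have h1 : `|f X - f (Y + Z)| < delta.
  by apply: hr; rewrite -ball_normE/= opprD addrA.
have h2 : `|f (Y + Z) - f Y| <= M * Num.sqrt C * Num.sqrt (q (X - Y)).
  apply: le_trans (lipschitz_comb _ _ _) _; rewrite -mulrA ler_wpM2l//.
  rewrite -(@ler_pXn2r _ 2)// ?nnegrE; last 2 first.
  - by rewrite sumr_ge0// => d _; rewrite mulr_ge0.
  - by rewrite mulr_ge0 ?sqrtr_ge0.
  apply: le_trans (sum_CauchySchwarz ep0 _ _) _.
  rewrite exprMn !sqr_sqrtr ?(diag_ge0 TD)//.
  apply: ler_pM; [exact: sumr_ge0| |exact: hC|exact: (diag_le TD)].
  exact: (qsum_ge0 TD s (X - Y)).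
rewrite -(subrK (f (Y + Z)) (f X)) -addrA addrC.
apply: le_trans (ler_normD _ _) _; rewrite lerD// ltW//.
Qed.

End directional_lipschitz.

Section complex_parts.
Context (R : realType).
Local Notation C := R[i].

(* The real part and the imaginary part are treated uniformly, as additive maps
   that commute with real factors and are bounded by the modulus. *)
Definition real_part_like (L : C -> R) :=
  [/\ forall x y, L (x - y) = L x - L y,
      forall (a : R) x, L (a%:C%C * x) = a * L x
    & forall x, `|L x| <= Normc.normc x].

Lemma Re_real_part : real_part_like (@complex.Re R).
Proof.
split; first by case=> a b [c d].
- by move=> a [x y] /=; rewrite mul0r subr0.
- case=> a b /=; rewrite -[leLHS]normr_id -sqrtr_sqr ler_wsqrtr//.
  by rewrite real_normK ?num_real// lerDl sqr_ge0.
Qed.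

Lemma Im_real_part : real_part_like (@complex.Im R).
Proof.
split; first by case=> a b [c d].
- by move=> a [x y] /=; rewrite mul0r addr0.
- case=> a b /=; rewrite -[leLHS]normr_id -sqrtr_sqr ler_wsqrtr//.
  by rewrite real_normK ?num_real// lerDr sqr_ge0.
Qed.

Lemma normc_ReIm (z : C) : Normc.normc z <= `|complex.Re z| + `|complex.Im z|.
Proof.
case: z => a b /=; rewrite -[leRHS]ger0_norm ?addr_ge0// -sqrtr_sqr.
rewrite ler_wsqrtr// sqrrD !real_normK ?num_real// addrAC lerDl.
by rewrite mulrn_wge0// mulr_ge0.
Qed.

Lemma cvg_real_part (L : C -> R) (T : Type) (F : set_system T) {FF : Filter F}
    (f : T -> C^o) (l : C^o) : real_part_like L ->
  f @ F --> l -> (L \o f) @ F --> L l.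
Proof.
move=> [LB _ Ln] /cvgrPdist_lt fl; apply/cvgrPdist_lt => r r0.
have r0' : (0 : C) < r%:C%C by rewrite ltcR.
apply: filterS (fl _ r0') => t; rewrite /= -LB => h.
by apply: le_lt_trans (Ln _) _; move: h; rewrite normc_def ltcR; case: (l - f t).
Qed.

Context (K : hilbertType R).

(** The mean value theorem is a statement about real values, so [L] is applied first and the theorem
    is used along the line through [X] directed by [a]. *)
Lemma real_part_dderiv (L : C -> R) (f G : K -> C) (a : K) (B : R) :
  real_part_like L ->
  (forall X, (t^-1)%:C%C * (f (X + t *: a) - f X) @[t --> (0 : R)^'] --> (G X : C^o)) ->
  (forall X, Normc.normc (G X) <= B) ->
  forall X t, `|L (f (X + t *: a)) - L (f X)| <= B * `|t|.
Proof.
move=> Lp fG GB X t; have [LB LZ Ln] := Lp.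
pose phi (s : R) := L (f (X + s *: a)).
have dphi (s : R) : is_derive s 1 phi (L (G (X + s *: a))).
  have h := cvg_real_part Lp (@fG (X + s *: a)).
  (* An increment of [phi] at [s] is an increment of [f] along [a] from the translated point
     [X + s *: a]. *)
  have h' : s0^-1 *: (phi (s0 *: 1 + s) - phi s) @[s0 --> (0 : R)^'] --> L (G (X + s *: a)).
    rewrite (_ : (fun s0 => _) = L \o (fun r : R => (r^-1)%:C%C *
      (f (X + s *: a + r *: a) - f (X + s *: a)))); first exact: h.
    apply/funext => s0; rewrite /= LZ LB /phi; congr (_ * (L (f _) - _)).
    by rewrite [s0 *: 1]mulr1 scalerDl -addrA; congr +%R; rewrite addrC.
  split; first by apply/cvg_ex; exists (L (G (X + s *: a))).
  exact: cvg_lim h'.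
have mvt u v : u < v -> `|phi v - phi u| <= B * `|v - u|.
  move=> uv; have dphi' s : s \in `]u, v[ -> is_derive s 1 phi (L (G (X + s *: a))).
    by move=> _; exact: dphi.
  have cphi : {within `[u, v], continuous phi}.
    apply: continuous_subspaceT => s; apply: differentiable_continuous.
    by apply/derivable1_diffP; have [] := dphi s.
  have [c _ ->] := MVT uv dphi' cphi.
  rewrite normrM ler_wpM2r//; apply: le_trans (Ln _) (GB _).
have -> : L (f X) = phi 0 by rewrite /phi scale0r addr0.
rewrite -/(phi t); case: (ltgtP t 0) => [t0|t0|->].
- by have := mvt _ _ t0; rewrite distrC sub0r normrN.
- by have := mvt _ _ t0; rewrite subr0.
- by rewrite subrr normr0 mulr0.
Qed.

End complex_parts.

Section symbol_lipschitz.
Context (R : realType) (H : hilbertType R) (Gamma : countType).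
Context (e : Gamma -> H) (eps : Gamma -> R).
Hypotheses (e_basis : hilbert_basis e) (eps_gt0 : forall j, 0 < eps j).
Hypothesis eps_sum : bounded_sums eps.

(** The multi-index whose only entry is a 1 at [d] is listed by [[:: d]], and its product of weights
    reduces to one factor. *)
Lemma symbol_dderiv (m : nat) (M : R) (F : hprod H H -> R[i]^o) d :
  (0 < m)%N -> symbol_class_bound e m M eps F ->
  exists2 G, is_dderiv F (direction e d) G &
    forall X, Normc.normc (G X) <= M * weight eps d.
Proof.
move=> m0 [_ _ hF].
pose j0 := match d with inl j | inr j => j end.
pose alpha j : nat := (d == inl j); pose beta j : nat := (d == inr j).
have fin1 (P : Gamma -> nat) : (forall j, P j != 0%N -> j = j0) ->
    finite_set [set j | P j != 0%N].
  by move=> PJ; apply: (@sub_finite_set _ _ [set j0]) => // j /PJ.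
have ha : forall j, alpha j != 0%N -> j = j0.
  by move=> j; rewrite eqb0 negbK /j0 => /eqP ->.
have hb : forall j, beta j != 0%N -> j = j0.
  by move=> j; rewrite eqb0 negbK /j0 => /eqP ->.
have hm j : (alpha j <= m)%N /\ (beta j <= m)%N.
  by split; exact: leq_trans (leq_b1 _) m0.
have hl : lists_multiindex alpha beta [:: d] by move=> j; rewrite /= !addn0.
have [G [[G' -> dG] _ GM]] := hF alpha beta (fin1 _ ha) (fin1 _ hb) hm _ hl.
exists G => // X; apply: le_trans (GM X) _.
rewrite (_ : \big[*%R/1]_(j \in _) _ = weight eps d)//.
rewrite -(@fsbig_widen _ _ _ _ [set j0] [set: Gamma])//=.
  rewrite fsbig_set1 /alpha /beta /j0.
  by case: d {j0 alpha beta fin1 ha hb hm hl dG GM} => j; rewrite eqxx.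
move=> j /= [_ /eqP jj0]; rewrite (_ : (alpha j + beta j)%N = 0%N)//.
apply/eqP; rewrite addn_eq0; apply/andP; split.
  by apply: contraNT jj0 => /ha ->.
by apply: contraNT jj0 => /hb ->.
Qed.

Lemma symbol_lipschitz (m : nat) (F : hprod H H -> R[i]^o) (L : R[i] -> R) :
  (0 < m)%N -> symbol_class e m eps F -> real_part_like L ->
  exists2 c, 0 <= c &
    forall X Y, `|L (F X) - L (F Y)| <= c * normA e eps (X - Y).
Proof.
move=> m0 [M M0 SM] Lp.
have TD := opA_diagonal e_basis eps_gt0 eps_sum.
apply: (@diag_lipschitz _ _ _ _ _ _ TD (fun X => L (F X)) M) => //.
- by move=> X; have [_ Fc _] := SM; exact: cvg_real_part Lp (@Fc X).
- move=> d X t; have [G dG GM] := symbol_dderiv d m0 SM.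
  exact: (real_part_dderiv Lp dG GM).
Qed.

End symbol_lipschitz.

(** * Extension to the completion *)

(** The extension is an infimum of cones with vertices over the points [i a]. The point [x0] makes
    this infimum one over a nonempty set and, by the Lipschitz bound, supplies a lower bound.
    Besides the two parts of [F], the coordinate forms in [dual_direction] are extended in this
    way. *)
Lemma mcshane_extension (R : realType) (X : Type) (x0 : X) (W : normedModType R)
    (i : X -> W) (f : X -> R) (L : R) : 0 <= L ->
  (forall a b, `|f a - f b| <= L * `|i a - i b|) ->
  exists2 g : W -> R, (forall x y, `|g x - g y| <= L * `|x - y|) &
    forall a, g (i a) = f a.
Proof.
move=> L0 fL; pose E x := [set f a + L * `|x - i a| | a in [set: X]].
have E_inf x : has_inf (E x).
  split; first by exists (f x0 + L * `|x - i x0|), x0.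
  exists (f x0 - L * `|x - i x0|) => _ [a _ <-].
  have := fL x0 a; rewrite ler_norml => /andP[_ h].
  have : L * `|i x0 - i a| <= L * `|x - i x0| + L * `|x - i a|.
    by rewrite -mulrDr ler_wpM2l// (distrC x) ler_distD.
  by lra.
pose g x := inf (E x).
have g_le x a : g x <= f a + L * `|x - i a|.
  by apply: ge_inf; [case: (E_inf x)|exists a].
have g_lip x y : g x <= g y + L * `|x - y|.
  rewrite -lerBlDr; apply: lb_le_inf; first by case: (E_inf y).
  move=> _ [a _ <-]; rewrite lerBlDr; apply: le_trans (g_le x a) _.
  by rewrite -addrA lerD2l -mulrDr ler_wpM2l// [leRHS]addrC ler_distD.
exists g => [x y|a].
  rewrite ler_norml; have := g_lip x y; have := g_lip y x.
  by rewrite (distrC y); lra.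
apply/eqP; rewrite eq_le; apply/andP; split.
  by have := g_le (i a) a; rewrite subrr normr0 mulr0 addr0.
apply: lb_le_inf; first by case: (E_inf (i a)).
by move=> _ [b _ <-]; have := fL a b; rewrite ler_norml => /andP[_]; lra.
Qed.

Lemma lipschitz_continuous (R : realType) (V W : normedModType R) (f : V -> W)
    (L : R) :
  (forall x y, `|f x - f y| <= L * `|x - y|) -> continuous f.
Proof.
move=> fL x; apply/cvgrPdist_lt => r r0.
have L1 : 0 < `|L| + 1 by rewrite ltr_wpDl.
near=> y; apply: le_lt_trans (fL x y) _.
have : `|x - y| < r / (`|L| + 1) by near: y; apply: cvgr_dist_lt => //; exact: divr_gt0.
rewrite ltr_pdivlMr// mulrC; apply: le_lt_trans; rewrite ler_wpM2r//.
by rewrite (le_trans (ler_norm _))// lerDl.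
Unshelve. all: by end_near. Qed.

Section completion.
Context (R : realType) (K : hilbertType R) (D : eqType).
Context (g : D -> K) (ep : D -> R) (T : K -> K).
Hypothesis TD : diagonal_form g ep T.
Local Notation q X := (dotp (T X) X).
Context (W : completeNormedModType R) (iota : K -> W).
Hypothesis iotaW : is_completion (fun X => Num.sqrt (q X)) iota.

Lemma completion_approx (x : W) (r : R) : 0 < r ->
  exists X, `|x - iota X| < r.
Proof.
move=> r0; have [_ _ di] := iotaW.
have [||z [xz [X _ Xz]]] := di (ball x r).
- by exists x; exact: ballxx.
- exact: ball_open.
by exists X; move: xz; rewrite -ball_normE Xz.
Qed.

(** Closed conditions pass from the dense image of [K] to [W]; linearity of the extended forms and
    the comparison of finite sums with the norm are transferred by this principle. *)
Lemma completion_ge0 (phi : W -> R) : continuous phi ->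
  (forall X, 0 <= phi (iota X)) -> forall x, 0 <= phi x.
Proof.
move=> cphi phi0 x; apply/ler_addgt0Pr => r r0.
have /cvgrPdist_lt/(_ _ r0)/nbhs_ballP[s /= s0 hs] := @cphi x.
have [X xX] := completion_approx x s0.
have : `|phi x - phi (iota X)| < r by apply: hs; rewrite -ball_normE.
by rewrite ltr_norml => /andP[]; have := phi0 X; lra.
Qed.

Lemma completion_eq0 (phi : W -> R) : continuous phi ->
  (forall X, phi (iota X) = 0) -> forall x, phi x = 0.
Proof.
move=> cphi phi0 x; apply/eqP; rewrite eq_le; apply/andP; split.
  rewrite -oppr_ge0; apply: (completion_ge0 (phi := fun y => - phi y)) => [y|X].
    by apply: cvgN; exact: cphi.
  by rewrite phi0 oppr0.
by apply: completion_ge0 => // X; rewrite phi0.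
Qed.

Lemma iotaB X Y : iota (X - Y) = iota X - iota Y.
Proof.
have [il _ _] := iotaW.
by rewrite addrC -scaleN1r il scaleN1r addrC.
Qed.

(** From [ep d * dotp X (g d) ^+ 2 <= q X], the coordinate is Lipschitz for the norm of the form,
    with constant [(Num.sqrt (ep d))^-1]. The extension is at first only Lipschitz; linearity is
    recovered by density, in [y] and then in [x]. *)
Lemma dual_direction d : exists y', dual_repr iota y' (g d).
Proof.
have [il iN _] := iotaW.
have sep0 : 0 < Num.sqrt (ep d) by rewrite sqrtr_gt0 (diag_gt0 TD).
have [|X Y|y' yL yE] := @mcshane_extension R K 0 W iota (fun X => dotp (g d) X)
    (Num.sqrt (ep d))^-1.
- by rewrite invr_ge0 ltW.
- rewrite -dotpBr -iotaB iN ler_pdivlMl//.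
  rewrite -[leLHS]ger0_norm ?mulr_ge0 ?(ltW sep0)// -[leLHS]sqrtr_sqr ler_wsqrtr//.
  rewrite exprMn sqr_sqrtr ?(ltW (diag_gt0 TD d))// real_normK ?num_real// dotpC.
  by have := diag_le TD (s := [:: d]) (X - Y) isT; rewrite /qsum big_seq1.
have cy : continuous y' by exact: lipschitz_continuous yL.
exists y'; split=> // a x y; apply/eqP; rewrite -subr_eq0; apply/eqP; move: y.
have cl (u : R) (z : W) : continuous (fun x => y' (u *: x + z)).
  move=> x'; apply: (continuous_comp (f := fun x => u *: x + z)); last exact: cy.
  by apply: cvgD; [apply: cvgZl_tmp; exact: cvg_id|exact: cvg_cst].
apply: completion_eq0 => [y|Y].
  apply: cvgB; last by apply: cvgD; [exact: cvg_cst|exact: cy].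
  apply: (continuous_comp (f := fun y => a *: x + y)); last exact: cy.
  by apply: cvgD; [exact: cvg_cst|exact: cvg_id].
move: x; apply: completion_eq0 => [x|X].
  apply: cvgB; first exact: cl.
  apply: cvgD; last exact: cvg_cst.
  by apply: cvgMr; exact: cy.
by rewrite -il !yE dotpDr dotpZr subrr.
Qed.

Context (y' : D -> W -> R).
Hypothesis y'E : forall d, dual_repr iota (y' d) (g d).

(** This is [qsum] carried over to [W], where the extended forms replace the inner products; it
    makes the norm of [W] accessible to integration. *)
Definition dual_qsum (s : seq D) (x : W) := \sum_(d <- s) ep d * y' d x ^+ 2.

Lemma dual_qsum_iota s X : dual_qsum s (iota X) = qsum g ep s X.
Proof.
apply: eq_bigr => d _; have [_ _ ->] := y'E d.
by rewrite dotpC.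
Qed.

Lemma dual_familyD d x y : y' d (x + y) = y' d x + y' d y.
Proof. by have [/(_ 1 x y) + _ _] := y'E d; rewrite scale1r mul1r. Qed.

Lemma dual_familyB d x y : y' d (x - y) = y' d x - y' d y.
Proof.
have [/(_ (-1) y x) + _ _] := y'E d.
by rewrite scaleN1r mulN1r (addrC (- y)) => ->; rewrite addrC.
Qed.

Lemma dual_qsum_le2 s x y :
  dual_qsum s (x + y) <= 2 * (dual_qsum s x + dual_qsum s y).
Proof.
rewrite -big_split mulr_sumr; apply: ler_sum => d _ /=.
rewrite dual_familyD -mulrDr [leRHS]mulrCA ler_wpM2l ?(ltW (diag_gt0 TD d))//.
by have := sqr_ge0 (y' d x - y' d y); nra.
Qed.

Lemma dual_qsum_le s x : uniq s -> dual_qsum s x <= `|x| ^+ 2.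
Proof.
move=> us; rewrite -subr_ge0; move: x; apply: completion_ge0 => [x|X].
  apply: cvgB.
    by apply: (cvgM (f := fun x : W => `|x|)); exact: norm_continuous.
  apply: cvg_big => [|d _]; first exact: add_continuous.
  apply: cvgMr.
  by have [_ c _] := y'E d; apply: (cvgM (f := y' d)); exact: c.
have [_ -> _] := iotaW.
by rewrite subr_ge0 dual_qsum_iota sqr_sqrtr ?(diag_ge0 TD)// (diag_le TD).
Qed.

(* The optimal constant is 1; 4 is enough for the estimates in mean square. *)
Lemma dual_qsum_norm x c : (forall s, uniq s -> dual_qsum s x <= c) ->
  `|x| ^+ 2 <= 4 * c.
Proof.
move=> hc; apply/ler_addgt0Pr => delta d0.
(* The square of a sum is bounded twice by twice the sum of squares; the total is
   [4 * c + 6 * (delta / 6)]. *)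
have r0 : 0 < Num.sqrt (delta / 6) by rewrite sqrtr_gt0 divr_gt0.
have [X xX] := completion_approx x r0.
have h1 : `|x - iota X| ^+ 2 <= delta / 6.
  rewrite -[leRHS]sqr_sqrtr ?divr_ge0 ?(ltW d0)//.
  by rewrite ler_pXn2r ?nnegrE// ltW.
have [_ iN _] := iotaW.
have h2 : q X <= 2 * (c + delta / 6).
  apply: (diag_ub TD) => s us; rewrite -dual_qsum_iota.
  rewrite -[iota X](subrK x) addrC; apply: le_trans (dual_qsum_le2 _ _ _) _.
  rewrite ler_wpM2l// lerD ?hc//.
  by apply: le_trans (dual_qsum_le _ us) _; rewrite distrC.
have h3 : `|x| ^+ 2 <= 2 * (`|x - iota X| ^+ 2 + `|iota X| ^+ 2).
  have : `|x| <= `|x - iota X| + `|iota X|.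
    by rewrite -{1}(subrK (iota X) x) ler_normD.
  rewrite -(@ler_pXn2r _ 2)// ?nnegrE ?addr_ge0// => /le_trans; apply.
  by have := sqr_ge0 (`|x - iota X| - `|iota X|); nra.
move: h3; rewrite iN sqr_sqrtr ?(diag_ge0 TD)//; lra.
Qed.

End completion.

(** * Convergence in mean square *)

Section measurability.
Context (R : realType).

Lemma borel_measurable_fun (W : completeNormedModType R) (phi : W -> R) :
  continuous phi -> measurable_fun [set: borel W] phi.
Proof.
move=> /continuousP cphi.
apply: (measurability _ (RGenOpens.measurableE R)).
move=> _ [_ [a [b ->] <-]]; rewrite setTI.
by apply: sub_sigma_algebra; exact/cphi/interval_open.
Qed.

(* An open subset of R^n is a countable union of boxes with rational centres. *)
Lemma measurable_comb d (X : measurableType d) (K : normedModType R) n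
    (w : 'I_n -> K) (l : 'I_n -> X -> R) (f : K -> R) :
  (forall i, measurable_fun setT (l i)) -> continuous f ->
  measurable_fun setT (fun x => f (\sum_i l i x *: w i)).
Proof.
move=> ml cf; apply: (measurability _ (RGenOpens.measurableE R)).
move=> _ [_ [a [b ->] <-]]; rewrite setTI.
pose U := f @^-1` `]a, b[; have oU : open U.
  by move/continuousP : cf; apply; exact: interval_open.
pose box (p : {ffun 'I_n -> rat} * nat) (c : 'I_n -> R) :=
  forall i, `|c i - ratr (p.1 i)| < p.2.+1%:R^-1.
pose ok p := forall c, box p c -> U (\sum_i c i *: w i).
pose V p : set X := if `[< ok p >] then [set x | box p (l^~ x)] else set0.
have -> : (fun x => f (\sum_i l i x *: w i)) @^-1` `]a, b[ = \bigcup_p V p.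
  apply/seteqP; split=> [x Ux|x [p _]]; last first.
    by rewrite /V; case: asboolP => // okp /okp.
  have /(@nbhs_ballP R) [r /= r0 hr] : nbhs (\sum_i l i x *: w i) U.
    by apply: open_nbhs_nbhs; split.
  (* Two points of a box of radius [k.+1%:R^-1] give combinations at distance less than
     [2 / k.+1%:R * M]; [k] is chosen to make this smaller than [r]. *)
  pose M := \sum_i `|w i| + 1.
  have M0 : 0 < M by rewrite ltr_wpDl// sumr_ge0.
  have [k hk] : exists k : nat, 2 * M / r < k.+1%:R.
    exists (Num.truncn (2 * M / r)).
    exact: truncnS_gt.
  have k0 : 0 < k.+1%:R^-1 :> R by rewrite invr_gt0.
  have /choice[p hp] : forall i, exists p : rat, `|l i x - ratr p| < k.+1%:R^-1.
    move=> i; move: k0; set c := k.+1%:R^-1 => k0.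
    have : l i x - c < l i x + c by rewrite ltrD2l gtrN.
    move=> /rat_in_itvoo[p]; rewrite in_itv/= => /andP[h1 h2]; exists p.
    by rewrite distrC ltr_distl h1 h2.
  exists ([ffun i => p i], k) => //; rewrite /V; case: asboolP => [_ i|].
    by rewrite ffunE.
  case=> c hc; apply: hr; rewrite -ball_normE/= -sumrB.
  apply: le_lt_trans (ler_norm_sum _ _ _) _.
  apply: (@le_lt_trans _ _ (\sum_i (2 * k.+1%:R^-1) * `|w i|)).
    apply: ler_sum => i _; rewrite -scalerBl normrZ ler_wpM2r//.
    have := hp i; have := hc i; rewrite /= ffunE distrC => h1 h2.
    rewrite (le_trans (ler_distD (ratr (p i)) _ _))// mulr_natl mulr2n.
    by rewrite lerD// ltW// distrC.
  rewrite -mulr_sumr; apply: (@lt_le_trans _ _ (2 / k.+1%:R * M)).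
    by rewrite ltr_pM2l ?mulr_gt0// ltrDl.
  by move: hk; rewrite ltr_pdivrMr// => /ltW hk; rewrite mulrAC ler_pdivrMr// [leRHS]mulrC.
apply: countable_bigcupT_measurable; first exact: countableP.
move=> p; rewrite /V; case: ifPn => // _.
rewrite (_ : [set x | _] = \bigcap_(i in [set: 'I_n])
    [set x | `|l i x - ratr (p.1 i)| < p.2.+1%:R^-1]).
  apply: fin_bigcap_measurable; first exact: finite_finset.
  move=> i _; pose r := ratr (p.1 i) : R; pose c := p.2.+1%:R^-1 : R.
  rewrite (_ : [set x | _] = setT `&` l i @^-1` `]r - c, r + c[).
    exact: ml.
  by apply/seteqP; split=> x; rewrite /= in_itv/= ltr_distl ?setTI// => -[].
by apply/seteqP; split=> x /= h i; [move=> _|]; exact: h.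
Qed.

End measurability.

Section gaussian_duals.
Context (R : realType) (K : hilbertType R).
Context (W : completeNormedModType R) (iota : K -> W).

Lemma dual_repr_comb (I : Type) (s : seq I) (c : I -> R) (y : I -> K)
    (y' : I -> W -> R) : (forall i, dual_repr iota (y' i) (y i)) ->
  dual_repr iota (fun x => \sum_(i <- s) c i * y' i x) (\sum_(i <- s) c i *: y i).
Proof.
move=> yE; split.
- move=> a u v; rewrite mulr_sumr -big_split; apply: eq_bigr => i _ /=.
  by have [-> _ _] := yE i; rewrite /=; ring.
- move=> x; apply: cvg_big => [|i _]; first exact: add_continuous.
  by apply: cvgMr; have [_ c' _] := yE i; exact: c'.
- move=> x; rewrite dotp_suml; apply: eq_bigr => i _.
  by have [_ _ ->] := yE i; rewrite dotpZl.
Qed.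

Lemma dual_reprB (u v : K) (u' v' : W -> R) :
  dual_repr iota u' u -> dual_repr iota v' v ->
  dual_repr iota (fun x => u' x - v' x) (u - v).
Proof.
move=> [ul uc uE] [vl vc vE]; split.
- by move=> a x y; rewrite ul vl /=; ring.
- by move=> x; apply: cvgB; [exact: uc|exact: vc].
- by move=> x; rewrite uE vE dotpBl.
Qed.

Lemma dual_reprZ (a : R) (u : K) (u' : W -> R) :
  dual_repr iota u' u -> dual_repr iota (fun x => a * u' x) (a *: u).
Proof.
move=> [ul uc uE]; split.
- by move=> b x y; rewrite ul /=; ring.
- by move=> x; apply: cvgMr; exact: uc.
- by move=> x; rewrite uE dotpZl.
Qed.

Context (mu : probability (borel W) R) (h : R) (h0 : 0 < h).
Hypothesis mu_gauss : gaussian_measure iota h mu.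
Hypothesis iota_dense : dense (range iota).

Let id_lin : linear (@idfun K). Proof. by []. Qed.
Let id_sym : symmetric_op (@idfun K). Proof. by []. Qed.

Lemma dual_measurable (y : K) (y' : W -> R) : dual_repr iota y' y ->
  measurable_fun [set: borel W] y'.
Proof. by move=> [_ cy _]; exact: borel_measurable_fun. Qed.

(** The Gaussian hypothesis enters here, for a family of one vector: the law of [y'] then has a
    one-dimensional density. The later mean-square estimates all rest on this moment. *)
Lemma dual_moment1 (y : K) (y' : W -> R) : dual_repr iota y' y -> `|y| = 1 ->
  (\int[mu]_x (y' x ^+ 2)%:E = gauss_moment2 h)%E.
Proof.
move=> yE y1.
pose phi (x : borel W) : 1.-tuple (measurableTypeR R) := [tuple (y' x : R) | i < 1].
have mphi : measurable_fun setT phi.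
  apply/measurable_fun_tnthP => i.
  rewrite (_ : _ \o _ = y'); first exact: dual_measurable yE.
  by apply/funext => x; rewrite /= tnth_mktuple.
have oy : orthonormal_family (fun _ : 'I_1 => y).
  by move=> i j; rewrite !ord1 eqxx dotpxx y1 expr1n.
have yE' : forall i : 'I_1, dual_repr iota ((fun=> y') i) ((fun=> y) i) by [].
have muE := mu_gauss oy yE'.
pose f (v : 1.-tuple (measurableTypeR R)) : \bar R :=
  (dotp (\sum_i (tnth v i : R) *: y) (\sum_i (tnth v i : R) *: y))%:E.
have mf : measurable_fun setT f.
  apply/measurable_EFinP.
  exact: (@measurable_form_tuple R K idfun id_sym 1 (fun=> y)).
have f0 v : (0 <= f v)%E by rewrite lee_fin dotp_ge0.
transitivity (\int[mu]_x f (phi x))%E.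
  apply: eq_integral => x _; congr EFin.
  by rewrite big_ord1 tnth_mktuple dotpZl dotpZr dotpxx y1; ring.
rewrite (@ge0_integral_image_density _ _ _ _ R mu phi mphi (lebesgue_tuple R 1)
  (@gauss_pdf R 1 h))//; last 2 first.
- by move=> v; exact: gauss_pdf_ge0.
- exact: measurable_gauss_pdf.
under eq_integral do rewrite -EFinM.
rewrite (integral_gauss_form h0 id_lin id_sym (@dotp_ge0 R K) (fun=> y)).
by rewrite big_ord1/= dotpxx y1 expr1n mule1.
Qed.

Lemma dual_moment (y : K) (y' : W -> R) : dual_repr iota y' y ->
  (\int[mu]_x (y' x ^+ 2)%:E = gauss_moment2 h * (`|y| ^+ 2)%:E)%E.
Proof.
move=> yE; have [y0|y0] := eqVneq y 0.
  rewrite y0 normr0 expr0n mule0.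
  (* The zero vector cannot be normalised; its form vanishes on the dense image, hence everywhere by
     continuity. *)
  have y'0 x : y' x = 0.
    have [_ cy yy] := yE; apply/eqP; rewrite -normr_le0; apply/ler_addgt0Pr => r r0.
    have /cvgrPdist_lt/(_ _ r0)/nbhs_ballP[s /= s0 hs] := @cy x.
    have [||z [xz [X _ Xz]]] := iota_dense (O := ball x s).
    - by exists x; exact: ballxx.
    - exact: ball_open.
    have := hs _ xz; rewrite -Xz yy y0 dotp0l subr0 add0r; exact: ltW.
  by under eq_integral do rewrite y'0 expr0n; rewrite integral0.
have ny : 0 < `|y| by rewrite normr_gt0.
have uE := dual_reprZ `|y|^-1 yE.
have u1 : `| `|y|^-1 *: y| = 1.
  by rewrite normrZ normfV normr_id mulVf ?gt_eqF.
rewrite -(dual_moment1 uE u1) muleC -ge0_integralZl_EFin//; last 2 first.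
- by move=> x _; rewrite lee_fin sqr_ge0.
- by apply/measurable_EFinP/measurable_funX; exact: dual_measurable uE.
apply: eq_integral => x _; rewrite -EFinM; congr EFin.
by rewrite exprMn exprVn mulVKf// expf_neq0// gt_eqF.
Qed.

Lemma Lnorm2_lt (f : borel W -> R) (r : R) :
  ('N[mu]_2%:E[(fun x => (f x)%:E)] < r%:E)%E ->
  (\int[mu]_x (f x ^+ 2)%:E <= (r ^+ 2)%:E)%E.
Proof.
move=> fr.
have E : ('N[mu]_2%:E[(fun x => (f x)%:E)] `^ 2 = \int[mu]_x (f x ^+ 2)%:E)%E.
  rewrite poweR_Lnorm//; apply: eq_integral => x _.
  by rewrite abse_EFin poweR_EFin powR_mulrn// real_normK ?num_real.
rewrite -E -(powR_mulrn 2); last first.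
  by rewrite -lee_fin (le_trans _ (ltW fr))// Lnorm_ge0.
rewrite -poweR_EFin gt0_ler_poweR// ?in_itv/= ?leey ?andbT ?Lnorm_ge0//; last exact: ltW.
by rewrite (le_trans _ (ltW fr))// Lnorm_ge0.
Qed.

End gaussian_duals.

Section square_integrals.
Context d (X : measurableType d) (R : realType) (mu : {measure set X -> \bar R}).
Local Open Scope ereal_scope.

Lemma integral_sqrD (a b : X -> R) :
  measurable_fun setT a -> measurable_fun setT b ->
  \int[mu]_x ((a x + b x) ^+ 2)%:E <=
  2%:E * \int[mu]_x (a x ^+ 2)%:E + 2%:E * \int[mu]_x (b x ^+ 2)%:E.
Proof.
move=> ma mb.
have m2 (f : X -> R) : measurable_fun setT f ->
    measurable_fun setT (fun x => (f x ^+ 2)%:E).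
  by move=> mf; apply/measurable_EFinP; exact: measurable_funX.
have sq0 (f : X -> R) x : 0 <= (f x ^+ 2)%:E by rewrite lee_fin sqr_ge0.
rewrite -!ge0_integralZl_EFin//; [|exact: m2|exact: m2].
rewrite -ge0_integralD//.
- apply: ge0_le_integral => //.
  + by move=> x _; exact: (sq0 (a \+ b)%R).
  + by apply: m2; exact: measurable_funD.
  + by apply: emeasurable_funD; apply: measurable_funeM; exact: m2.
  + move=> x _; rewrite -!EFinM -EFinD lee_fin.
    by have := sqr_ge0 (a x - b x)%R; nra.
- by move=> x _; rewrite mule_ge0.
- by apply: measurable_funeM; exact: m2.
- by move=> x _; rewrite mule_ge0.
- by apply: measurable_funeM; exact: m2.
Qed.

(** Cauchy-Schwarz with unit weights, whence the factor [n%:R]. The crude bound suffices, because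
    [r] is made small with [n] and [c] fixed. *)
Lemma integral_sqr_sum n (f : 'I_n -> X -> R) (c : 'I_n -> R) (r : R) :
  (forall i, measurable_fun setT (f i)) ->
  (forall i, \int[mu]_x (f i x ^+ 2)%:E <= r%:E) ->
  \int[mu]_x ((\sum_i c i * f i x)%R ^+ 2)%:E <=
  (n%:R * (\sum_i c i ^+ 2) * r)%R%:E.
Proof.
move=> mf hf.
have m2 i : measurable_fun setT (fun x => (f i x ^+ 2)%:E).
  by apply/measurable_EFinP; exact: measurable_funX.
apply: (@le_trans _ _ (\int[mu]_x ((n%:R)%:E * \sum_i (c i ^+ 2)%:E * (f i x ^+ 2)%:E))).
  apply: ge0_le_integral => //.
  - by move=> x _; rewrite lee_fin sqr_ge0.
  - apply/measurable_EFinP/measurable_funX/measurable_sum => i.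
    exact: measurable_funM.
  - apply: measurable_funeM; apply: emeasurable_sum => i _.
    exact: measurable_funeM.
  - move=> x _.
    have -> : \sum_i (c i ^+ 2)%:E * (f i x ^+ 2)%:E =
        (\sum_i c i ^+ 2 * f i x ^+ 2)%R%:E.
      by rewrite -sumEFin; apply: eq_bigr => i _; rewrite EFinM.
    rewrite -EFinM lee_fin.
    have := @sum_CauchySchwarz R 'I_n (fun=> 1%R) (fun=> ler01)
      (fun i => c i * f i x)%R (index_enum 'I_n).
    rewrite big_const_ord iter_addr_0 => h.
    apply: (@le_trans _ _ ((\sum_i 1 * `|c i * f i x|)%R ^+ 2)%R).
      rewrite -real_normK ?num_real// ler_pXn2r ?nnegrE ?sumr_ge0//.
      + apply: le_trans (ler_norm_sum _ _ _) _.
        by apply: ler_sum => i _; rewrite mul1r.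
    apply: le_trans h _; rewrite ler_wpM2l//; apply: ler_sum => i _.
    by rewrite mul1r exprMn.
rewrite ge0_integralZl_EFin//; last 2 first.
- by move=> x _; apply: sume_ge0 => i _; rewrite mule_ge0// lee_fin sqr_ge0.
- by apply: emeasurable_sum => i _; exact: measurable_funeM.
rewrite -mulrA EFinM lee_wpmul2l//.
rewrite ge0_integral_sum//; last 2 first.
- by move=> i; exact: measurable_funeM.
- by move=> i x _; rewrite mule_ge0// lee_fin sqr_ge0.
rewrite mulr_suml -sumEFin; apply: lee_sum => i _.
rewrite ge0_integralZl_EFin//; last 2 first.
- by move=> x _; rewrite lee_fin sqr_ge0.
- exact: sqr_ge0.
by rewrite [leRHS]EFinM lee_wpmul2l// lee_fin sqr_ge0.
Qed.

End square_integrals.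

Section exhaustion.
Context (D : countType).

(** The elements with code below [k]: increasing finite lists that cover [D], finite or not.
    Monotone convergence and the choice of subspaces both require such a sequence. *)
Definition exhaust (k : nat) : seq D := pmap pickle_inv (seq.iota 0 k).

Lemma exhaust_uniq k : uniq (exhaust k).
Proof. by apply: (pmap_uniq (@pickle_invK D)); exact: iota_uniq. Qed.

Lemma mem_exhaust k d : (d \in exhaust k) = (choice.pickle d < k)%N.
Proof.
rewrite mem_pmap; apply/mapP/idP => [[m]|dk].
  rewrite mem_iota add0n => /= mk dm; have := @pickle_invK D m.
  by rewrite -dm /= => ->.
by exists (choice.pickle d); rewrite ?pickleK_inv// mem_iota.
Qed.

Lemma exhaust_mono k k' : (k <= k')%N -> {subset exhaust k <= exhaust k'}.
Proof. by move=> kk' d; rewrite !mem_exhaust => /leq_trans; apply. Qed.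

Lemma sub_exhaust (s : seq D) : exists k, {subset s <= exhaust k}.
Proof.
exists (\max_(d <- s) (choice.pickle d).+1)%N => d ds; rewrite mem_exhaust.
by rewrite (big_rem d)//= leq_max leqnn.
Qed.

End exhaustion.

Section projection_moment.
Context (R : realType) (K : hilbertType R) (D : countType).
Context (g : D -> K) (ep : D -> R) (T : K -> K).
Hypothesis TD : diagonal_form g ep T.
Local Notation q X := (dotp (T X) X).
Context (W : completeNormedModType R) (iota : K -> W).
Hypothesis iotaW : is_completion (fun X => Num.sqrt (q X)) iota.
Context (mu : probability (borel W) R) (h : R) (h0 : 0 < h).
Hypothesis mu_gauss : gaussian_measure iota h mu.
Context (y' : D -> W -> R).
Hypothesis y'E : forall d, dual_repr iota (y' d) (g d).

Let iota_dense : dense (range iota). Proof. by have [] := iotaW. Qed.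

(** Finite combinations of the [g d] belong to W', which is therefore dense in [K]; this gives
    content to the limit condition in [is_ell]. *)
Lemma dual_approx (a : K) (r : R) : 0 < r ->
  exists z z', dual_repr iota z' z /\ `|z - a| < r.
Proof.
move=> r0; have [s us hs] := diag_total TD a r0.
exists (proj_seq g s a), (fun x => \sum_(d <- s) dotp a (g d) * y' d x).
by split; [exact: dual_repr_comb|rewrite distrC].
Qed.

Definition moment2 : R := fine (gauss_moment2 h).

Lemma moment2E : gauss_moment2 h = moment2%:E.
Proof. by rewrite fineK// ge0_fin_numE ?gauss_moment2_lty ?gauss_moment2_ge0. Qed.

Lemma moment2_ge0 : 0 <= moment2.
Proof. by rewrite -lee_fin -moment2E gauss_moment2_ge0. Qed.

Context (n : nat) (w : 'I_n -> K) (l : 'I_n -> borel W -> R).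
Hypothesis wl : forall i, is_ell iota mu (w i) (l i).

(** A representative is known only through the forms of vectors close to [a]. Closeness [delta]
    yields the mean-square bound and closeness [eta] the bound in [K], hence the minimum. *)
Lemma is_ell_approx (a : K) (f : borel W -> R) (eta : R) : 0 < eta ->
  is_ell iota mu a f ->
  exists p : K * (W -> R), [/\ dual_repr iota p.2 p.1, `|p.1 - a| <= eta &
    (\int[mu]_x ((p.2 x - f x) ^+ 2)%:E <= (eta ^+ 2)%:E)%E].
Proof.
move=> eta0 [mf _ /(_ _ eta0)[delta d0 hd]].
have r0 : 0 < Num.min delta eta by rewrite lt_min d0.
have [z [z' [zE]]] := dual_approx a r0.
rewrite lt_min => /andP[z1 z2]; exists (z, z'); split=> //=; first exact: ltW.
by apply: Lnorm2_lt; exact: hd zE z1.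
Qed.

(** Heuristically, the difference is the form of [y - orthoproj w y]. Since the [w i] need not lie
    in W', they are replaced by nearby vectors that do: this leaves a continuous form [u'] of known
    moment and an error [v]. The factor 2 comes from squaring [u' + v], and [eta] is arbitrarily
    small. *)
Lemma tpi_moment (y : K) (f : W -> R) : dual_repr iota f y ->
  (\int[mu]_x ((f x - dotp y (tpi w l x)) ^+ 2)%:E <=
   (2 * moment2 * `|y - orthoproj w y| ^+ 2)%:E)%E.
Proof.
move=> fy; pose c i := dotp y (w i).
pose A := `|y - orthoproj w y|; pose B := \sum_i `|c i|.
pose Cn := n%:R * \sum_i c i ^+ 2.
have B0 : 0 <= B by exact: sumr_ge0.
have Cn0 : 0 <= Cn by rewrite mulr_ge0// sumr_ge0// => i _; exact: sqr_ge0.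
have m0 := moment2_ge0.
(* The coefficient of [eta] in the final bound: the first part comes from expanding
   [(A + B * eta) ^+ 2], the second from the moment of [v]. Taking [eta <= 1] absorbs the squares of
   [eta]. *)
pose Q := 2 * moment2 * (2 * A * B + B ^+ 2) + 2 * Cn.
have Q0 : 0 <= Q.
  have A0 : 0 <= A by exact: normr_ge0.
  apply: addr_ge0; apply: mulr_ge0 => //; first exact: mulr_ge0.
  by apply: addr_ge0; [apply: mulr_ge0 => //; exact: mulr_ge0|exact: sqr_ge0].
apply/lee_addgt0Pr => r r0; pose eta := Num.min 1 (r / (Q + 1)).
have eta0 : 0 < eta by rewrite lt_min ltr01 divr_gt0// ltr_wpDl.
have eta1 : eta <= 1 by rewrite ge_min lexx.
have eta2 : eta ^+ 2 <= eta.
  by rewrite expr2 -[leRHS]mul1r ler_wpM2r// ltW.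
have etar : eta * Q <= r.
  have : eta <= r / (Q + 1) by rewrite ge_min lexx orbT.
  rewrite ler_pdivlMr ?ltr_wpDl//; apply: le_trans.
  by rewrite ler_wpM2l ?(ltW eta0)// lerDl.
have /choice[p hp] i := is_ell_approx eta0 (wl i).
have zE : forall i, dual_repr iota (p i).2 (p i).1 by move=> i; have [] := hp i.
pose u' x := f x - \sum_i c i * (p i).2 x.
have uE : dual_repr iota u' (y - \sum_i c i *: (p i).1).
  by apply: dual_reprB => //; exact: dual_repr_comb.
pose v (x : borel W) := \sum_i c i * ((p i).2 x - l i x).
have ml i : measurable_fun setT (l i) by have [] := wl i.
have mpl i : measurable_fun setT (fun x : borel W => (p i).2 x - l i x).
  apply: measurable_funB => //; exact: dual_measurable (zE i).
have mv : measurable_fun setT v.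
  by apply: measurable_sum => i; exact: measurable_funM.
have -> : (fun x => ((f x - dotp y (tpi w l x)) ^+ 2)%:E) =
    (fun x => ((u' x + v x) ^+ 2)%:E).
  apply/funext => x; congr (_ ^+ 2)%:E; rewrite /u' /v /tpi dotp_sumr.
  rewrite -addrA; congr +%R; rewrite -sumrN -sumrN -big_split; apply: eq_bigr => i _ /=.
  by rewrite dotpZr /c; ring.
apply: le_trans (integral_sqrD _ (dual_measurable uE) mv) _.
rewrite (dual_moment h0 mu_gauss iota_dense uE) moment2E.
have hv : (\int[mu]_x (v x ^+ 2)%:E <= (Cn * eta ^+ 2)%:E)%E.
  by apply: integral_sqr_sum => // i; have [] := hp i.
apply: (@le_trans _ _ ((2 * (moment2 * `|y - \sum_i c i *: (p i).1| ^+ 2))%:E +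
    (2 * (Cn * eta ^+ 2))%:E)%E).
  by rewrite !EFinM leeD2l// lee_wpmul2l.
rewrite -!EFinD lee_fin.
have hyp : `|y - \sum_i c i *: (p i).1| <= A + B * eta.
  have -> : y - \sum_i c i *: (p i).1 =
      (y - orthoproj w y) + \sum_i c i *: (w i - (p i).1).
    under [in RHS]eq_bigr do rewrite scalerBr.
    by rewrite sumrB addrA subrK.
  apply: le_trans (ler_normD _ _) _; rewrite lerD//.
  apply: le_trans (ler_norm_sum _ _ _) _; rewrite mulr_suml; apply: ler_sum => i _.
  by rewrite normrZ ler_wpM2l// distrC; have [] := hp i.
have hsq : `|y - \sum_i c i *: (p i).1| ^+ 2 <= A ^+ 2 + eta * (2 * A * B + B ^+ 2).
  have : `|y - \sum_i c i *: (p i).1| ^+ 2 <= (A + B * eta) ^+ 2.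
    by rewrite ler_pXn2r// nnegrE ?normr_ge0// (le_trans _ hyp).
  move=> /le_trans; apply; have : eta ^+ 2 * B ^+ 2 <= eta * B ^+ 2.
    by apply: ler_wpM2r => //; exact: sqr_ge0.
  by lra.
have := ler_wpM2l m0 hsq.
have : Cn * eta ^+ 2 <= Cn * eta by exact: ler_wpM2l.
move: etar; rewrite /Q -/A; lra.
Qed.


(** The measurable minorant [psi] spares a proof that the residual norm itself is measurable. In the
    constant 8, a factor 4 comes from [dual_qsum_norm] and a factor 2 from [tpi_moment]. *)
Lemma tpi_residual (psi : borel W -> R) (E : R) :
  measurable_fun setT psi -> (forall x, 0 <= psi x) ->
  (forall x, psi x <= `|(x : W) - iota (tpi w l x)| ^+ 2) ->
  (forall s, uniq s ->
    \sum_(d <- s) ep d * `|g d - orthoproj w (g d)| ^+ 2 <= E) ->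
  (\int[mu]_x (psi x)%:E <= (8 * moment2 * E)%:E)%E.
Proof.
move=> mpsi psi0 psi_le hE.
have ep0 d : 0 <= ep d by exact/ltW/(diag_gt0 TD).
have ml i : measurable_fun setT (l i) by have [] := wl i.
pose rd d (x : borel W) := y' d x - dotp (g d) (tpi w l x).
have mrd d : measurable_fun setT (rd d).
  apply: measurable_funB; first exact: dual_measurable (y'E d).
  rewrite (_ : (fun x => _) = (fun x => \sum_i l i x * dotp (g d) (w i))).
    by apply: measurable_sum => i; exact: measurable_funM.
  by apply/funext => x; rewrite dotp_sumr; apply: eq_bigr => i _; rewrite dotpZr.
have mrd2 d : measurable_fun setT (fun x => (rd d x ^+ 2)%:E).
  by apply/measurable_EFinP; exact: measurable_funX.
pose G k x : \bar R := (\sum_(d <- exhaust D k) (4 * ep d)%:E * (rd d x ^+ 2)%:E)%E.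
have GE k x : G k x = (4 * dual_qsum ep y' (exhaust D k) ((x : W) - iota (tpi w l x)))%:E.
  rewrite /dual_qsum mulr_sumr -sumEFin; apply: eq_bigr => d _.
  rewrite -EFinM mulrA; congr (_ * _ ^+ 2)%:E.
  by rewrite (dual_familyB y'E); have [_ _ ->] := y'E d.
have G0 k x : (0 <= G k x)%E.
  by apply: sume_ge0 => d _; rewrite mule_ge0 ?lee_fin ?sqr_ge0 ?mulr_ge0.
have mG k : measurable_fun setT (G k).
  by apply: emeasurable_sum => d _; exact: measurable_funeM.
have ndG x : nondecreasing_seq (G ^~ x).
  move=> k k' kk'; rewrite !GE lee_fin ler_wpM2l//.
  apply: ler_sum_subset; [|exact: exhaust_uniq|exact: exhaust_uniq|exact: exhaust_mono].
  by move=> d; rewrite mulr_ge0 ?sqr_ge0.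
(* Every finite list is contained in some [exhaust D k], so a quarter of the limit, when finite,
   bounds all the [dual_qsum] of the residual. *)
have psiG x : ((psi x)%:E <= limn (G ^~ x))%E.
  have Gl k : (G k x <= limn (G ^~ x))%E.
    have /cvg_lim -> // := ereal_nondecreasing_cvgn (ndG x).
    by apply: ereal_sup_ubound; exists k.
  move: Gl; case: (limn _) => [c| |] Gl; last 2 first.
  - exact: leey.
  - by have := le_trans (G0 0%N x) (Gl 0%N).
  rewrite lee_fin (le_trans (psi_le x))//.
  have -> : c = 4 * (c / 4) by rewrite mulrC divfK.
  apply: (dual_qsum_norm TD iotaW y'E) => s us; rewrite ler_pdivlMr// mulrC.
  have [k sk] := sub_exhaust s; have := Gl k; rewrite GE lee_fin.
  apply: le_trans; rewrite ler_wpM2l//.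
  apply: ler_sum_subset => //; last exact: exhaust_uniq.
  by move=> d; rewrite mulr_ge0 ?sqr_ge0.
apply: (@le_trans _ _ (\int[mu]_x limn (G ^~ x))%E).
  apply: ge0_le_integral => //.
  - by move=> x _; rewrite lee_fin.
  - exact/measurable_EFinP.
  - apply: (emeasurable_fun_cvg G) => // x _.
    exact: ereal_nondecreasing_is_cvgn.
rewrite monotone_convergence//.
apply: lime_le.
  apply: ereal_nondecreasing_is_cvgn => k k' kk'.
  by apply: ge0_le_integral => // x _; exact: ndG.
apply: nearW => k; rewrite ge0_integral_sum//; last 2 first.
- by move=> d; exact: measurable_funeM.
- by move=> d x _; rewrite mule_ge0 ?lee_fin ?sqr_ge0 ?mulr_ge0.
apply: (@le_trans _ _ (\sum_(d <- exhaust D k) (4 * ep d * (2 * moment2 *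
    `|g d - orthoproj w (g d)| ^+ 2))%:E)%E).
  apply: lee_sum => d _; rewrite ge0_integralZl_EFin//; last 2 first.
  - by move=> x _; rewrite lee_fin sqr_ge0.
  - by rewrite mulr_ge0.
  rewrite [leRHS]EFinM lee_wpmul2l ?lee_fin ?mulr_ge0//.
  exact: tpi_moment (y'E d).
rewrite sumEFin lee_fin.
have := ler_wpM2l (_ : 0 <= 8 * moment2) (hE _ (exhaust_uniq D k)).
rewrite mulr_ge0 ?moment2_ge0// => /(_ isT); apply: le_trans.
rewrite mulr_sumr le_eqVlt; apply/orP; left; apply/eqP; apply: eq_bigr => d _.
by ring.
Qed.

End projection_moment.

Section projection_convergence.
Context (R : realType) (K : hilbertType R) (D : eqType).
Context (g : D -> K) (ep : D -> R).
Hypotheses (og : orthonormal_family g) (ep_gt0 : forall d, 0 < ep d).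
Hypothesis ep_sum : bounded_sums ep.
Context (dim : nat -> nat) (w : forall n, 'I_(dim n) -> K).
Hypothesis ow : forall n, orthonormal_family (@w n).
Hypothesis w_mono : forall n, linspan (@w n) `<=` linspan (@w n.+1).
Hypothesis w_dense : dense (\bigcup_n linspan (@w n)).

Lemma orthoproj_best n (y z : K) : linspan (@w n) z ->
  `|y - orthoproj (@w n) y| <= `|y - z|.
Proof. by move=> [c ->]; exact: (proj_seq_best (@ow n)) (index_enum_uniq _). Qed.

(** As the spans increase, a point of one span close to [y] stays available to all later
    projections, which do at least as well. *)
Lemma orthoproj_cvg (y : K) (r : R) : 0 < r ->
  exists N, forall n, (N <= n)%N -> `|y - orthoproj (@w n) y| < r.
Proof.
move=> r0; have [||z [yz [N _ Nz]]] := w_dense (O := ball y r).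
- by exists y; exact: ballxx.
- exact: ball_open.
exists N => n Nn; have nz : linspan (@w n) z.
  rewrite -(subnK Nn); elim: (n - N)%N => [//|k IH].
  by rewrite addSn; exact: w_mono.
apply: le_lt_trans (orthoproj_best y nz) _.
by move: yz; rewrite -ball_normE.
Qed.

(** Dominated convergence for sums: outside [s0] the weights are small and a unit vector leaves a
    remainder of norm at most 1; on the finite list [s0] each term tends to 0. The bound is uniform
    in [s]. *)
Lemma orthoproj_weighted_cvg (r : R) : 0 < r ->
  exists N, forall n, (N <= n)%N -> forall s, uniq s ->
    \sum_(d <- s) ep d * `|g d - orthoproj (@w n) (g d)| ^+ 2 <= r.
Proof.
move=> r0; have r20 : 0 < r / 2 by rewrite divr_gt0.
have ep0 d : 0 <= ep d by exact: ltW.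
have [s0 us0 hs0] := bounded_sums_tail ep_sum r20.
have [C hC] := ep_sum.
have C0 : 0 <= C by have := hC [::] isT; rewrite big_nil.
have t0 : 0 < Num.sqrt (r / 2 / (C + 1)).
  by rewrite sqrtr_gt0 divr_gt0// ltr_wpDl.
have [N hN] : exists N, forall n, (N <= n)%N -> forall d, d \in s0 ->
    `|g d - orthoproj (@w n) (g d)| ^+ 2 <= r / 2 / (C + 1).
  elim: (s0) => [|d s [N hN]]; first by exists 0%N.
  have [N' hN'] := orthoproj_cvg (g d) t0.
  exists (maxn N N') => n; rewrite geq_max => /andP[Nn N'n] d'.
  rewrite inE => /orP[/eqP ->|]; last exact: hN.
  rewrite -[leRHS]sqr_sqrtr ?divr_ge0 ?addr_ge0 ?(ltW r0)//.
  rewrite ler_pXn2r ?nnegrE ?normr_ge0 ?sqrtr_ge0//; exact/ltW/hN'.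
exists N => n Nn s us.
rewrite (bigID (mem s0))/= [leRHS]splitr lerD//.
  apply: (@le_trans _ _ (\sum_(d <- s | d \in s0) ep d * (r / 2 / (C + 1)))).
    by apply: ler_sum => d ds0; rewrite ler_wpM2l// hN.
  rewrite -mulr_suml -big_filter.
  have h := hC _ (filter_uniq (mem s0) us).
  apply: le_trans (ler_wpM2r _ h) _; first by rewrite !divr_ge0 ?addr_ge0// ltW.
  by rewrite mulrCA ger_pMr// ler_pdivrMr ?ltr_wpDl// mul1r lerDl.
rewrite -big_filter ltW//.
apply: le_lt_trans (hs0 _ (filter_uniq (fun d => d \notin s0) us) _); last first.
  by move=> d; rewrite mem_filter => /andP[].
apply: ler_sum => d _; rewrite ler_piMr// expr_le1//.
have := proj_seq_le (@ow n) (g d) (index_enum_uniq _).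
by rewrite (orthonormal_norm _ og).
Qed.

End projection_convergence.

(** * Convergence in L^p *)

Section Lnorm_estimates.
Context d (X : measurableType d) (R : realType) (mu : probability X R) (p : R).
Hypothesis p1 : 1 <= p.

Let p0 : 0 < p. Proof. exact: lt_le_trans ltr01 p1. Qed.

Lemma LnormE (f : X -> R) : (forall x, 0 <= f x) ->
  ('N[mu]_(p%:E)[(fun x => (f x)%:E)] =
   (\int[mu]_x (f x `^ p)%:E) `^ p^-1)%E.
Proof.
move=> f0; rewrite unlock /Lnorm.
suff E (x : X) : (`|(f x)%:E| `^ p = (f x `^ p)%:E)%E by under eq_integral do rewrite E.
by rewrite abse_EFin poweR_EFin ger0_norm.
Qed.

Lemma Lnorm_le_bound (f : X -> R) (r : R) : (forall x, 0 <= f x) -> 0 <= r ->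
  (\int[mu]_x (f x `^ p)%:E <= (r `^ p)%:E)%E ->
  ('N[mu]_(p%:E)[(fun x => (f x)%:E)] <= r%:E)%E.
Proof.
move=> f0 r0 h; rewrite LnormE//.
have -> : r%:E = ((r `^ p)%:E `^ p^-1)%E.
  by rewrite poweR_EFin -powRrM divff ?gt_eqF// powRr1.
have I0 : (0 <= \int[mu]_x (f x `^ p)%:E)%E.
  by apply: integral_ge0 => x _; rewrite lee_fin powR_ge0.
rewrite gt0_ler_poweR// ?invr_ge0 ?(ltW p0)// in_itv/= leey ?andbT//.
by rewrite lee_fin powR_ge0.
Qed.

Lemma le_Lnorm (f f' : X -> R) : (forall x, 0 <= f x) ->
  (forall x, f x <= f' x) ->
  measurable_fun setT f -> measurable_fun setT f' ->
  ('N[mu]_(p%:E)[(fun x => (f x)%:E)] <=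
   'N[mu]_(p%:E)[(fun x => (f' x)%:E)])%E.
Proof.
move=> f0 ff' mf mf'; have f'0 x : 0 <= f' x by exact: le_trans (ff' x).
have mp (u : X -> R) : measurable_fun setT u ->
    measurable_fun setT (fun x => (u x `^ p)%:E).
  move=> mu'; apply/measurable_EFinP.
  exact: (measurableT_comp (measurable_powR p) mu').
have I0 (u : X -> R) : (0 <= \int[mu]_x (u x `^ p)%:E)%E.
  by apply: integral_ge0 => x _; rewrite lee_fin powR_ge0.
rewrite (LnormE f0) (LnormE f'0).
apply: gt0_ler_poweR; rewrite ?invr_ge0 ?(ltW p0) ?in_itv/= ?leey ?andbT ?I0//.
apply: ge0_le_integral => //.
- by move=> x _; rewrite lee_fin powR_ge0.
- exact: mp.
- exact: mp.
- by move=> x _; rewrite lee_fin ge0_ler_powR ?nnegrE ?(ltW p0).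
Qed.

Lemma bounded_Lnorm (f : X -> R) (C : R) : measurable_fun setT f ->
  (forall x, 0 <= f x <= C) -> ('N[mu]_(p%:E)[(fun x => (f x)%:E)] < +oo)%E.
Proof.
move=> mf fC; have f0 x : 0 <= f x by have /andP[] := fC x.
(* The sign of [C] is deduced from a point of [X]; with no point, the integral is one over the empty
   set. *)
have [x0|noX] := pselect (exists x0 : X, True); last first.
  apply: (@le_lt_trans _ _ 1%E); last exact: ltry.
  apply: Lnorm_le_bound => //; rewrite powR1.
  have XE : [set: X] = set0 by apply/seteqP; split=> // x _; apply: noX; exists x.
  by rewrite XE integral_set0.
have C0 : 0 <= C by have [x _] := x0; have /andP[] := fC x; exact: le_trans.
apply: (@le_lt_trans _ _ C%:E); last exact: ltry.
apply: Lnorm_le_bound => //.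
apply: (@le_trans _ _ (\int[mu]_x (cst (C `^ p)%:E x))%E).
  apply: ge0_le_integral => //.
  - by move=> x _; rewrite lee_fin powR_ge0.
  - apply/measurable_EFinP; exact: (measurableT_comp (measurable_powR p) mf).
  - move=> x _; have /andP[? ?] := fC x.
    by rewrite lee_fin ge0_ler_powR ?nnegrE ?(ltW p0).
by rewrite integral_cst//= probability_setT mule1.
Qed.

(* A bounded sequence that converges to 0 in mean square converges to 0 in every
   L^p, because [u `^ p <= eta `^ p + C `^ p / eta ^+ 2 * u ^+ 2] on [0, C]. *)
Lemma bounded_L2_cvg_Lp (f : nat -> X -> R) (C : R) : 0 <= C ->
  (forall n, measurable_fun setT (f n)) ->
  (forall n x, 0 <= f n x <= C) ->
  (forall r, 0 < r -> exists N, forall n, (N <= n)%N ->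
     (\int[mu]_x (f n x ^+ 2)%:E <= r%:E)%E) ->
  ('N[mu]_(p%:E)[(fun x => (f n x)%:E)] @[n --> \oo] --> 0)%E.
Proof.
move=> C0 mf fC f2.
have f0 n x : 0 <= f n x by have /andP[] := fC n x.
suff h (r : R) : 0 < r -> exists N, forall n, (N <= n)%N ->
    ('N[mu]_(p%:E)[(fun x => (f n x)%:E)] <= r%:E)%E.
  apply/fine_cvgP; split.
    have [N hN] := h 1 ltr01; exists N => // n Nn /=.
    by rewrite ge0_fin_numE ?Lnorm_ge0// (le_lt_trans (hN n Nn))// ltry.
  apply/cvgrPdist_le => r r0; have [N hN] := h r r0; exists N => // n Nn /=.
  have fn := Lnorm_ge0 mu p%:E (fun x => (f n x)%:E).
  rewrite sub0r normrN ger0_norm ?fine_ge0// -lee_fin fineK ?hN//.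
  by rewrite ge0_fin_numE// (le_lt_trans (hN n Nn))// ltry.
(* The power [p] of [eta] is half that of [r]; the other half is left to the mean-square term. *)
move=> r0; pose eta := r * 2^-1 `^ p^-1.
have eta0 : 0 < eta by rewrite mulr_gt0// powR_gt0.
have etap : eta `^ p = r `^ p / 2.
  by rewrite powRM ?powR_ge0 ?(ltW r0)// -powRrM mulVf ?gt_eqF// powRr1.
pose k := C `^ p / eta ^+ 2.
have k0 : 0 <= k by rewrite divr_ge0 ?powR_ge0 ?sqr_ge0.
have s0 : 0 < r `^ p / 2 / (k + 1).
  by rewrite !divr_gt0 ?powR_gt0// ltr_wpDl.
have [N hN] := f2 _ s0; exists N => n Nn.
have mf2 : measurable_fun setT (fun x => (f n x ^+ 2)%:E).
  by apply/measurable_EFinP; exact: measurable_funX.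
have sq0 x : (0 <= (f n x ^+ 2)%:E)%E by rewrite lee_fin sqr_ge0.
apply: Lnorm_le_bound => //; first exact: ltW.
apply: (@le_trans _ _ (\int[mu]_x ((eta `^ p)%:E + k%:E * (f n x ^+ 2)%:E))%E).
  apply: ge0_le_integral => //.
  - by move=> x _; rewrite lee_fin powR_ge0.
  - apply/measurable_EFinP; exact: (measurableT_comp (measurable_powR p) (mf n)).
  - by apply: emeasurable_funD => //; exact: measurable_funeM.
  - move=> x _; rewrite -EFinM -EFinD lee_fin.
    have [fe|ef] := leP (f n x) eta.
      apply: (@le_trans _ _ (eta `^ p)).
        by rewrite ge0_ler_powR ?nnegrE ?(ltW p0) ?(ltW eta0).
      by rewrite lerDl mulr_ge0 ?sqr_ge0.
    apply: (@le_trans _ _ (k * f n x ^+ 2)); last by rewrite lerDr powR_ge0.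
    rewrite /k -mulrA [_^-1 * _]mulrC.
    apply: (@le_trans _ _ (C `^ p)).
      by have /andP[? ?] := fC n x; rewrite ge0_ler_powR ?nnegrE ?(ltW p0).
    rewrite ler_peMr ?powR_ge0// ler_pdivlMr ?exprn_gt0// mul1r.
    by rewrite ler_pXn2r ?nnegrE ?f0 ?ltW.
rewrite ge0_integralD//; last 3 first.
- by move=> x _; rewrite lee_fin powR_ge0.
- by move=> x _; rewrite mule_ge0.
- exact: measurable_funeM.
rewrite integral_cst//= probability_setT mule1 ge0_integralZl_EFin//.
apply: (@le_trans _ _ ((eta `^ p)%:E + k%:E * (r `^ p / 2 / (k + 1))%:E)%E).
  by rewrite leeD2l// lee_wpmul2l// hN.
rewrite -EFinM -EFinD lee_fin etap [leRHS]splitr lerD2l mulrCA.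
rewrite ger_pMr ?divr_gt0 ?powR_gt0// ler_pdivrMr ?ltr_wpDl// mul1r.
by rewrite lerDl.
Qed.

End Lnorm_estimates.

Section complex_Lp.
Context (R : realType).

Lemma normcE (z : R[i]) :
  Normc.normc z = (complex.Re z ^+ 2 + complex.Im z ^+ 2) `^ 2^-1.
Proof. by case: z => a b; rewrite powR12_sqrt// addr_ge0 ?sqr_ge0. Qed.

Lemma normc_ge0 (z : R[i]) : 0 <= Normc.normc z.
Proof. by rewrite normcE powR_ge0. Qed.

Lemma measurable_normc d (X : measurableType d) (f : X -> R[i]) :
  measurable_fun setT (fun x => complex.Re (f x)) ->
  measurable_fun setT (fun x => complex.Im (f x)) ->
  measurable_fun setT (fun x => Normc.normc (f x)).
Proof.
move=> mr mi; under eq_fun do rewrite normcE.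
apply: (measurableT_comp (measurable_powR 2^-1)).
by apply: measurable_funD; exact: measurable_funX.
Qed.

Lemma measurable_normcB d (X : measurableType d) (f f' : X -> R[i]) :
  measurable_fun setT (fun x => complex.Re (f x)) ->
  measurable_fun setT (fun x => complex.Im (f x)) ->
  measurable_fun setT (fun x => complex.Re (f' x)) ->
  measurable_fun setT (fun x => complex.Im (f' x)) ->
  measurable_fun setT (fun x => Normc.normc (f x - f' x)).
Proof.
move=> mr mi mr' mi'; apply: measurable_normc.
  rewrite (_ : (fun x => _) = (fun x => complex.Re (f x) - complex.Re (f' x))).
    exact: measurable_funB.
  by apply/funext => x; have [-> _ _] := @Re_real_part R.
rewrite (_ : (fun x => _) = (fun x => complex.Im (f x) - complex.Im (f' x))).
  exact: measurable_funB.
by apply/funext => x; have [-> _ _] := @Im_real_part R.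
Qed.

Lemma normc_oppr (z : R[i]) : Normc.normc (- z) = Normc.normc z.
Proof. by rewrite !normcE; case: z => a b /=; rewrite !sqrrN. Qed.

Lemma normcB_le (x y : R[i]) :
  Normc.normc (x - y) <= Normc.normc x + Normc.normc y.
Proof. by rewrite -(normc_oppr y); exact: le_normcD. Qed.

Lemma ler_normcB (x y z : R[i]) :
  Normc.normc (x - z) <= Normc.normc (y - x) + Normc.normc (y - z).
Proof.
have -> : x - z = (y - z) - (y - x) by ring.
by rewrite [leRHS]addrC; exact: normcB_le.
Qed.

Context d (X : measurableType d) (mu : probability X R) (p : R) (p1 : 1 <= p).

(** Minkowski's inequality, applied to moduli, bounds the norm of [f - f'] by a sum that tends to
    0. *)
Lemma normc_ae_eq (f f' : X -> R[i]) (u : nat -> X -> R[i]) :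
  measurable_fun setT (fun x => complex.Re (f x)) ->
  measurable_fun setT (fun x => complex.Im (f x)) ->
  measurable_fun setT (fun x => complex.Re (f' x)) ->
  measurable_fun setT (fun x => complex.Im (f' x)) ->
  (forall n, measurable_fun setT (fun x => complex.Re (u n x))) ->
  (forall n, measurable_fun setT (fun x => complex.Im (u n x))) ->
  ('N[mu]_(p%:E)[(fun x => (Normc.normc (u n x - f x))%:E)] @[n --> \oo] --> 0)%E ->
  ('N[mu]_(p%:E)[(fun x => (Normc.normc (u n x - f' x))%:E)] @[n --> \oo] --> 0)%E ->
  {ae mu, forall x, f x = f' x}.
Proof.
move=> mr mi mr' mi' ur ui uf uf'.
have N0 : ('N[mu]_(p%:E)[(fun x => (Normc.normc (f x - f' x))%:E)] = 0)%E.
  apply/eqP; rewrite eq_le Lnorm_ge0 andbT.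
  have := cvgeD _ uf uf'; rewrite adde0 => /(_ _ isT) h.
  apply: (cvge_ge _ h); apply: nearW => n.
  apply: (@le_trans _ _ ('N[mu]_(p%:E)[(fun x => (Normc.normc (u n x - f x) +
      Normc.normc (u n x - f' x))%:E)])%E).
    apply: le_Lnorm => //.
    - by move=> x; exact: normc_ge0.
    - by move=> x; exact: ler_normcB.
    - exact: measurable_normcB.
    - by apply: measurable_funD; exact: measurable_normcB.
  apply: (minkowski_EFin mu (f := fun x => Normc.normc (u n x - f x))) => //.
    exact: measurable_normcB.
  exact: measurable_normcB.
have mN : measurable_fun setT (fun x => (Normc.normc (f x - f' x))%:E).
  by apply/measurable_EFinP; exact: measurable_normcB.
have := Lnorm_eq0_eq0 mN _ N0; rewrite lte_fin (lt_le_trans ltr01 p1) => /(_ isT).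
apply: filterS => x /(_ I) [h]; apply/eqP; rewrite -subr_eq0; apply/eqP.
exact: Normc.eq0_normc h.
Qed.

End complex_Lp.

Section linear_span.
Context (R : realType) (K : hilbertType R) (n : nat) (w : 'I_n -> K).

Lemma linspan_comb (I : eqType) (s : seq I) (c : I -> R) (v : I -> K) :
  (forall i, i \in s -> linspan w (v i)) ->
  linspan w (\sum_(i <- s) c i *: v i).
Proof.
move=> wv; rewrite big_seq; apply: (big_ind (linspan w)).
- by exists (fun=> 0); rewrite big1// => i _; rewrite scale0r.
- move=> _ _ [a ->] [b ->]; exists (fun i => a i + b i).
  by rewrite -big_split; apply: eq_bigr => i _; rewrite scalerDl.
- move=> i /wv[b ->]; exists (fun j => c i * b j).
  by rewrite scaler_sumr; apply: eq_bigr => j _; rewrite scalerA.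
Qed.

Lemma linspan_self j : linspan w (w j).
Proof.
exists (fun i => (i == j)%:R); rewrite (bigD1 j)//= eqxx scale1r big1 ?addr0//.
by move=> i /negPf ->; rewrite scale0r.
Qed.

End linear_span.

(** * Identification with the stochastic extension *)

Section extension.
Context (R : realType) (K : hilbertType R) (D : countType).
Context (g : D -> K) (ep : D -> R) (T : K -> K).
Hypothesis TD : diagonal_form g ep T.
Local Notation q X := (dotp (T X) X).
Context (W : completeNormedModType R) (iota : K -> W).
Hypothesis iotaW : is_completion (fun X => Num.sqrt (q X)) iota.
Context (F : K -> R[i]) (FA : W -> R[i]) (C L : R).
Hypotheses (F_cont : continuous (F : K -> R[i]^o)) (L0 : 0 <= L).
Hypothesis FC : forall X, Normc.normc (F X) <= C.
Hypothesis FA_lip : forall x y, Normc.normc (FA x - FA y) <= L * `|x - y|.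
Hypothesis FAE : forall X, FA (iota X) = F X.
Context (mu : probability (borel W) R) (h : R) (h0 : 0 < h).
Hypothesis mu_gauss : gaussian_measure iota h mu.
Context (p : R) (p1 : 1 <= p).

Let C0 : 0 <= C. Proof. exact: le_trans (normc_ge0 _) (FC 0). Qed.

(** Some point of the image lies within distance 1 of [x], which costs at most [L]; any finite bound
    serves the purpose. *)
Lemma extension_bound x : Normc.normc (FA x) <= C + L.
Proof.
have [X xX] := completion_approx iotaW x ltr01.
have -> : FA x = (FA x - FA (iota X)) - (- FA (iota X)) by rewrite opprK subrK.
apply: le_trans (normcB_le _ _) _; rewrite normc_oppr addrC lerD// ?FAE//.
rewrite -FAE; apply: le_trans (FA_lip _ _) _.
by rewrite -[leRHS]mulr1 ler_wpM2l// ltW.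
Qed.

Lemma extension_part (P : R[i] -> R) : real_part_like P ->
  measurable_fun [set: borel W] (fun x => P (FA x)).
Proof.
move=> [PB _ Pn]; apply: borel_measurable_fun.
apply: (@lipschitz_continuous _ _ _ _ L) => x y; rewrite -PB.
exact: le_trans (Pn _) (FA_lip _ _).
Qed.

Lemma bounded_in_Lp (f : borel W -> R[i]) (B : R) :
  (forall P, real_part_like P -> measurable_fun setT (fun x => P (f x))) ->
  (forall x, Normc.normc (f x) <= B) -> in_Lp mu p f.
Proof.
move=> mf fB; have mr := mf _ (@Re_real_part R); have mi := mf _ (@Im_real_part R).
split=> //; apply: (@bounded_Lnorm _ _ _ mu p p1 _ B).
  exact: measurable_normc.
by move=> x; rewrite normc_ge0 fB.
Qed.

Lemma tpi_part n (w : 'I_n -> K) (l : 'I_n -> borel W -> R) (P : R[i] -> R) :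
  (forall i, is_ell iota mu (w i) (l i)) -> real_part_like P ->
  measurable_fun setT (fun x => P (F (tpi w l x))).
Proof.
move=> wl Pp; apply: (@measurable_comb R _ _ K n w l (fun X => P (F X))) => [i|X].
  by have [] := wl i.
exact: cvg_real_part Pp (@F_cont X).
Qed.

Lemma extension_stochastic : stochastic_extension iota mu p F FA.
Proof.
have mA := extension_part; split.
  by apply: (bounded_in_Lp (B := C + L)) => // x; exact: extension_bound.
move=> dim w l ow w_mono w_dense wl.
have mF n P : real_part_like P ->
    measurable_fun setT (fun x => P (F (tpi (w n) (l n) x))).
  exact: (tpi_part (wl n)).
split=> [n|]; first exact: bounded_in_Lp (mF n) (fun x => FC _).
pose f n x := Normc.normc (F (tpi (w n) (l n) x) - FA x).
have mf n : measurable_fun setT (f n).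
  apply: measurable_normcB.
  - exact: mF (@Re_real_part R).
  - exact: mF (@Im_real_part R).
  - exact: mA (@Re_real_part R).
  - exact: mA (@Im_real_part R).
have fC n x : 0 <= f n x <= C + (C + L).
  rewrite normc_ge0 /=; apply: le_trans (normcB_le _ _) _.
  by rewrite lerD// extension_bound.
apply: (bounded_L2_cvg_Lp p1 (C := C + (C + L))) => //.
  by rewrite !addr_ge0.
move=> r r0; have L1 : 0 < L + 1 by rewrite ltr_wpDl.
have m0 := moment2_ge0 h0.
pose k := (L + 1) ^+ 2 * (8 * moment2 h).
have k0 : 0 <= k by rewrite mulr_ge0 ?sqr_ge0// mulr_ge0.
have E0 : 0 < r / (k + 1) by rewrite divr_gt0// ltr_wpDl.
have [N hN] := orthoproj_weighted_cvg (diag_orthonormal TD) (diag_gt0 TD)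
  (diag_bounded TD) ow w_mono w_dense E0.
have /choice[y' y'E] := dual_direction TD iotaW.
(* [L + 1] is invertible even if [L = 0]. As [F] at the projected point is [FA] at its image, the
   Lipschitz bound places [psi] below the squared residual norm. *)
exists N => n Nn; pose psi (x : borel W) := (L + 1) ^- 2 * f n x ^+ 2.
have psi0 x : 0 <= psi x by rewrite mulr_ge0 ?sqr_ge0// invr_ge0 sqr_ge0.
have mpsi : measurable_fun setT psi.
  by apply: measurable_funM => //; exact: measurable_funX.
have psi_le x : psi x <= `|(x : W) - iota (tpi (w n) (l n) x)| ^+ 2.
  rewrite /psi ler_pdivrMl ?exprn_gt0// -exprMn.
  have /andP[fx0 _] := fC n x.
  rewrite ler_pXn2r ?nnegrE ?mulr_ge0 ?(ltW L1)// /f -FAE distrC.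
  by apply: le_trans (FA_lip _ _) _; rewrite ler_wpM2r// lerDl.
have := tpi_residual TD iotaW h0 mu_gauss y'E (wl n) mpsi psi0 psi_le
  (hN n Nn).
have -> : (\int[mu]_x (f n x ^+ 2)%:E =
    ((L + 1) ^+ 2)%:E * \int[mu]_x (psi x)%:E)%E.
  rewrite -ge0_integralZl_EFin//; last 3 first.
  - by move=> x _; rewrite lee_fin.
  - exact/measurable_EFinP.
  - exact: sqr_ge0.
  apply: eq_integral => x _; rewrite -EFinM; congr EFin.
  by rewrite /psi mulVKf// expf_neq0// gt_eqF.
move=> hI; apply: le_trans (lee_wpmul2l _ hI) _; first by rewrite lee_fin sqr_ge0.
rewrite -EFinM lee_fin mulrA -/k mulrCA ger_pMr//.
by rewrite ler_pdivrMr ?ltr_wpDl// mul1r lerDl.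
Qed.

(** By [dual_moment], the L^2 norm of a form is at most [Num.sqrt (moment2 h)] times the norm of its
    vector, so nearby vectors of W' have nearby forms. *)
Lemma dual_is_ell (y : K) (f : W -> R) : dual_repr iota f y ->
  is_ell iota mu y f.
Proof.
move=> fy; have iota_dense : dense (range iota) by have [] := iotaW.
have m0 := moment2_ge0 h0.
have N2 (z : K) (f' : W -> R) : dual_repr iota f' z ->
    ('N[mu]_2%:E[(fun x => (f' x)%:E)] <= (Num.sqrt (moment2 h) * `|z|)%:E)%E.
  move=> zE; have -> : ('N[mu]_2%:E[(fun x => (f' x)%:E)] =
      'N[mu]_2%:E[(fun x => (`|f' x|)%:E)])%E.
    by rewrite -Lnorm_abse.
  have r0 : 0 <= Num.sqrt (moment2 h) * `|z| by rewrite mulr_ge0 ?sqrtr_ge0.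
  apply: Lnorm_le_bound => //; first by rewrite ler1n.
  rewrite powR_mulrn ?mulr_ge0 ?sqrtr_ge0// exprMn sqr_sqrtr//.
  under eq_integral do rewrite powR_mulrn// real_normK ?num_real//.
  by rewrite (dual_moment h0 mu_gauss iota_dense zE) moment2E.
split.
- exact: dual_measurable fy.
- exact: le_lt_trans (N2 _ _ fy) (ltry _).
- move=> r r0; exists (r / (Num.sqrt (moment2 h) + 1)).
    by rewrite divr_gt0// ltr_wpDl ?sqrtr_ge0.
  move=> z z' zE; rewrite ltr_pdivlMr ?ltr_wpDl ?sqrtr_ge0// => hz.
  apply: le_lt_trans (N2 _ _ (dual_reprB zE fy)) _; rewrite lte_fin.
  by apply: le_lt_trans hz; rewrite mulrC ler_wpM2l// lerDl.
Qed.

(** The definition quantifies over sequences of subspaces, so an admissible one must be exhibited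
    before two limits can be compared. The spans of the [g d] with [d] in [exhaust D n] are chosen,
    since their basis vectors lie in W' and have explicit representatives. *)
Lemma stochastic_extension_unique (Ft : borel W -> R[i]) :
  stochastic_extension iota mu p F Ft -> {ae mu, forall x, Ft x = FA x}.
Proof.
have /choice[y' y'E] := dual_direction TD iotaW.
pose w n (i : 'I_(size (exhaust D n))) := g (tnth (in_tuple (exhaust D n)) i).
pose l n (i : 'I_(size (exhaust D n))) : borel W -> R :=
  y' (tnth (in_tuple (exhaust D n)) i).
have gw n d : d \in exhaust D n -> linspan (@w n) (g d).
  move=> dn; have /tnthP[i ->] : d \in in_tuple (exhaust D n) by [].
  exact: (linspan_self (@w n)).
have ow n : orthonormal_family (@w n).
  exact: (orthonormal_tnth TD (exhaust_uniq D n)).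
have w_mono n : linspan (@w n) `<=` linspan (@w n.+1).
  move=> _ [c ->]; apply: linspan_comb => i _; apply: gw.
  by apply: (exhaust_mono (leqnSn n)); exact: mem_tnth.
have w_dense : dense (\bigcup_n linspan (@w n)).
  move=> O [x Ox] oO.
  have /nbhs_ballP[r /= r0 hr] : nbhs x O by apply: open_nbhs_nbhs; split.
  have [s us hs] := diag_total TD x r0.
  exists (proj_seq g s x); split; first by apply: hr; rewrite -ball_normE.
  have [k sk] := sub_exhaust s; exists k => //.
  by apply: linspan_comb => d ds; apply: gw; exact: sk.
have wl n i : is_ell iota mu (@w n i) (@l n i) by exact: dual_is_ell (y'E _).
move=> [[Ftr Fti _] /(_ _ w l ow w_mono w_dense wl)[_ Ftc]].
have [_ /(_ _ w l ow w_mono w_dense wl)[_ FAc]] := extension_stochastic.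
apply: (normc_ae_eq p1 _ _ _ _ _ _ Ftc FAc) => //.
- by apply: extension_part; exact: Re_real_part.
- by apply: extension_part; exact: Im_real_part.
- by move=> n; apply: (tpi_part (wl n)); exact: Re_real_part.
- by move=> n; apply: (tpi_part (wl n)); exact: Im_real_part.
Qed.

End extension.

Theorem proposition4p7 (R : realType) (H : hilbertType R)
    (H_separable : separable_space H) (H_infinite : infinite_dimensional H)
    (N : H -> R) (N_measurable : measurable_norm N)
    (B : completeNormedModType R) (iB : H -> B)
    (B_completion : is_completion N iB)
    (Gamma : countType) (e : Gamma -> H) (e_basis : hilbert_basis e)
    (e_dual : forall j, in_dual iB (e j))
    (eps : Gamma -> R) (eps_gt0 : forall j, 0 < eps j)
    (eps_summable : esum.summable [set: Gamma] (fun j => (eps j)%:E)) :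
  (forall X : hprod H H,
     cvg (summability.partial_sum (opA_term e eps X) @ summability.totally)) /\
  [/\ symmetric_op (opA e eps),
      forall X, X != 0 -> 0 < dotp (opA e eps X) X,
      trace_class (opA e eps)
    & measurable_norm (normA e eps)] /\
  forall (BA : completeNormedModType R) (iA : hprod H H -> BA),
    is_completion (normA e eps) iA ->
  forall (m : nat) (F : hprod H H -> R[i]^o),
    (2 <= m)%N -> symbol_class e m eps F ->
  (forall eta : R, 0 < eta -> exists2 delta : R, 0 < delta &
     forall X Y, normA e eps (X - Y) < delta ->
       Normc.normc (F X - F Y) < eta) /\
  exists FA : BA -> R[i]^o,
    [/\ unif_continuous FA, forall X, FA (iA X) = F X
      & forall (h p : R) (mu : probability (borel BA) R),
          0 < h -> 1 <= p -> gaussian_measure iA h mu ->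
          (exists Ft, stochastic_extension iA mu p F Ft) /\
          (forall Ft, stochastic_extension iA mu p F Ft ->
             {ae mu, forall x, Ft x = FA x})].
Proof.
have eps_sum : bounded_sums eps.
  by apply: summable_bounded_sums => // j; exact: ltW.
have TD := opA_diagonal e_basis eps_gt0 eps_sum.
split; first by move=> X; exact: opA_cvg.
split.
  split; [exact: diag_sym TD|exact: diag_pos TD|exact: diag_trace_class TD|].
  exact: diag_measurable_norm TD.
move=> BA iA iAE m F m2 SF; have m1 : (0 < m)%N by exact: leq_trans m2.
have [a a0 Fa] := symbol_lipschitz e_basis eps_gt0 eps_sum m1 SF (@Re_real_part R).
have [b b0 Fb] := symbol_lipschitz e_basis eps_gt0 eps_sum m1 SF (@Im_real_part R).
have ab0 : 0 <= a + b by exact: addr_ge0.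
have ab1 : 0 < a + b + 1 by rewrite ltr_wpDl.
have F_lip X Y : Normc.normc (F X - F Y) <= (a + b) * normA e eps (X - Y).
  apply: le_trans (normc_ReIm _) _; rewrite mulrDl lerD//.
    by have [-> _ _] := @Re_real_part R; exact: Fa.
  by have [-> _ _] := @Im_real_part R; exact: Fb.
split.
  move=> eta eta0; exists (eta / (a + b + 1)); first exact: divr_gt0.
  move=> X Y; rewrite ltr_pdivlMr// => hXY; apply: le_lt_trans (F_lip X Y) _.
  by apply: le_lt_trans hXY; rewrite mulrC ler_wpM2l ?sqrtr_ge0// lerDl.
have iAB X Y : `|iA X - iA Y| = normA e eps (X - Y).
  by have [_ iN _] := iAE; rewrite -(iotaB iAE) iN.
have [|u u_lip uE] := @mcshane_extension R (hprod H H) 0 BA iA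
    (fun X => complex.Re (F X)) a a0.
  by move=> X Y; rewrite iAB; exact: Fa.
have [|v v_lip vE] := @mcshane_extension R (hprod H H) 0 BA iA
    (fun X => complex.Im (F X)) b b0.
  by move=> X Y; rewrite iAB; exact: Fb.
pose FA (x : BA) : R[i]^o := (u x +i* v x)%C.
have FA_lip x y : Normc.normc (FA x - FA y) <= (a + b) * `|x - y|.
  apply: le_trans (normc_ReIm _) _; rewrite mulrDl lerD//.
  - by have := u_lip x y.
  - by have := v_lip x y.
have FAE X : FA (iA X) = F X by rewrite /FA uE vE; case: (F X).
exists FA; split=> // [|h p mu h0 p1 mu_gauss].
  move=> E; rewrite -entourage_ballE => -[r /= r0 hr].
  (* Radii of balls in [R[i]] are complex numbers; positivity forces the imaginary part to
     vanish. *)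
  have [r1 r1E] : exists r1 : R, r = r1%:C%C.
    by exists (complex.Re r); case: r r0 {hr} => x y; rewrite ltcE/= => /andP[/eqP ->].
  move: r0 hr; rewrite r1E ltcR => r10 hr.
  rewrite /= -entourage_ballE; exists (r1 / (a + b + 1)); first exact: divr_gt0.
  move=> [x y]; rewrite /= -ball_normE/= ltr_pdivlMr// => hxy; apply: hr.
  rewrite /= -ball_normE/= normc_def ltcR.
  have := FA_lip x y; case: (FA x - FA y) => s t /= /le_lt_trans; apply.
  by apply: le_lt_trans hxy; rewrite mulrC ler_wpM2l// lerDl.
have [M M0 [[C FC] F_cont _]] := SF.
split.
  exists FA.
  exact: (extension_stochastic TD iAE F_cont ab0 FC FA_lip FAE h0 mu_gauss p1).
exact: (stochastic_extension_unique TD iAE F_cont ab0 FC FA_lip FAE h0 mu_gauss p1).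
Qed.
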